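(* Let $\alpha,\beta$ be integers different from $1$ with $v_2(\alpha-1)=v_2(\beta-1)=m>1$, and suppose $v_2(\alpha-\beta)=2m-1$. Then $|G_2|=2^{7m-3}$, the nilpotency class of $G_2$ is $5$, $o(a)=o(b)=2^{3m-1}$ and $o(c)=2^{2m}$.
   Context: $G(\alpha,\beta)=\langle A,B\mid A^{[A,B]}=A^{\alpha},\ B^{[B,A]}=B^{\beta}\rangle$ with $[x,y]=x^{-1}y^{-1}xy$, $y^x=x^{-1}yx$, and $C=[A,B]$. The group $G(\alpha,\beta)$ is finite and nilpotent, hence the direct product of its Sylow subgroups; $G_2$ denotes its Sylow $2$-subgroup and $a,b,c$ denote the images of $A,B,C$ under the canonical projection $G(\alpha,\beta)\to G_2$. $v_2$ is the $2$-adic valuation and $o(x)$ the order of $x$. *)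

(* Defs.v *)
From HB Require Import structures.
From mathcomp Require Import all_boot all_order all_algebra all_fingroup all_solvable.
Set Implicit Arguments. Unset Strict Implicit. Unset Printing Implicit Defensive.
Import GRing.Theory.

Local Open Scope group_scope.

Definition expgz (gT : finGroupType) (x : gT) (z : int) : gT :=
  match z with
  | Posz n => x ^+ n
  | Negz n => (x ^+ n.+1)^-1
  end.

(* The defining relations of G(alpha,beta):
   X^[X,Y] = X^alpha and Y^[Y,X] = Y^beta.
   MathComp: x ^ y = y^-1 x y,  [~ x, y] = x^-1 y^-1 x y, as in the paper. *)
Definition Grels (alpha beta : int) (hT : finGroupType) (x y : hT) : Prop :=
  x ^ [~ x, y] = expgz x alpha /\ y ^ [~ y, x] = expgz y beta.

(* (gT, A, B) is a (finite) realisation of the presentation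
   G(alpha,beta) = < A, B | A^[A,B] = A^alpha, B^[B,A] = B^beta >:
   gT is generated by A, B, the relations hold, and (A,B) is universal:
   any pair satisfying the relations in any finite group is the image of
   (A,B) under a group homomorphism.  Since G(alpha,beta) is finite, this
   determines gT up to an isomorphism sending A, B to the canonical
   generators. *)
Definition is_Gpres (alpha beta : int) (gT : finGroupType) (A B : gT) : Prop :=
  [set: gT] = <<[set A; B]>> /\ Grels alpha beta A B /\
  forall (hT : finGroupType) (x y : hT), Grels alpha beta x y ->
    exists f : gT -> hT, {morph f : u v / u * v >-> u * v} /\ f A = x /\ f B = y.

Definition v2 (z : int) : nat := logn 2 `|z|%N.

(* Main.v *)
Require Import Defs.
From HB Require Import structures.
From mathcomp Require Import all_boot all_order all_algebra all_fingroup all_solvable.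
From mathcomp Require Import zify ring.
Set Implicit Arguments. Unset Strict Implicit. Unset Printing Implicit Defensive.
Import GRing.Theory.

(**
  Write C = [A,B] and N = 2^(2m-1).  Since A^B = AC and C^B = B^(b-1) C, one has
  A^(B^j) = A B^e C^j with an explicit e.  Computing A^(B^b) = ((A^a)^B)^(C^-1) in two ways
  gives C^a = B^e C^b A^e' with e, e' of 2-adic valuation 2m-1; as C^a = C^(b+Nw) with w odd,
  B^e then acts on A as a power of C, and repeating the argument yields, in the Sylow
  2-subgroup, A^(2^(3m-1)) = 1, C^N = A^(2^(3m-2)) = B^(2^(3m-2)) and <A^N> = <B^N>.
  So A^N is central, <A> <= <A,C> <= <A,C,B^(2^m)> <= <A,B> is a chain with cyclic steps that
  bounds the order by 2^(7m-3), and the lower central series can be read off.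

  That a finite group satisfying the relations is nilpotent follows from the formula for
  A^(B^j): it makes <A,C,B^(c^k)>, c = (b-1)/2, a subnormal series, at the bottom of which
  <A> is normal, so that A (and likewise B) lies in the Fitting subgroup.

  For the lower bound, the chain above is realised by three successive cyclic extensions.
*)

(** * 2-adic valuations and the exponents cexp *)

(** Rewriting a relation and conjugating A with it raises the valuations of its exponents; the
    resulting relation between <A> and <B> is symmetric in A and B, but its two exponents, of
    valuation 4m-2 and 4m-1, are not, and this imbalance makes high powers vanish. The exact value
    of v2(alpha - beta) enters as the oddness of w.

    The constants of the model come from the chain itself. Put q = 2^m, t = A^N and y = B^q. As B^N
    lies in <t>, write B^N = t^kap; then A^y = t^i A C^q and C^y = t^j C, where i and j depend only
    on kap, v = (b-1)/q and q. Conjugation by B must preserve A^C = A^a, which leaves one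
    congruence, kap v^2 + r = 2^(m-1) modulo q, where r is given by [cexp a a] = a N r. It is
    solvable because v is odd. Each intermediate extension keeps its universal property, so that the
    next conjugation can be prescribed on generators.

    The upper bounds use only the relations. The universal property of G serves to map it onto the
    model, which is a 2-group and hence already an image of the Sylow 2-subgroup. *)

Definition v2is (k x : nat) : Prop := exists2 o, odd o & x = 2 ^ k * o.

Lemma v2is_gt0 k x : v2is k x -> 0 < x.
Proof. by move=> [o oo ->]; rewrite muln_gt0 expn_gt0 /= odd_gt0. Qed.

Lemma v2is_dvd k x : v2is k x -> 2 ^ k %| x.
Proof. by move=> [o _ ->]; apply: dvdn_mulr. Qed.

Lemma v2is_odd x : v2is 0 x <-> odd x.
Proof. by split=> [[o oo ->]|ox]; [rewrite expn0 mul1n | exists x; rewrite ?expn0 ?mul1n]. Qed.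

Lemma v2isM i j x y : v2is i x -> v2is j y -> v2is (i + j) (x * y).
Proof.
move=> [o oo ->] [p op ->]; exists (o * p); first by rewrite oddM oo.
by rewrite expnD; ring.
Qed.

Lemma v2isX2 k : v2is k (2 ^ k).
Proof. by exists 1; rewrite ?muln1. Qed.

Lemma v2isD k x y : v2is k x -> 2 ^ k.+1 %| y -> v2is k (x + y).
Proof.
move=> [o oo ->] /dvdnP[t ->]; exists (o + 2 * t); last by rewrite expnS; ring.
by rewrite oddD oddM oo.
Qed.

Lemma v2isDr k x y : v2is k (x + y) -> 2 ^ k.+1 %| y -> v2is k x.
Proof.
move=> [o oo E] /dvdnP[t Et].
have kp : 0 < 2 ^ k by rewrite expn_gt0.
exists (o - 2 * t).
  have le : 2 * t <= o by rewrite -(leq_pmul2l kp) -E Et expnS; lia.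
  by rewrite oddB // oddM oo.
by rewrite mulnBr -E Et expnS; lia.
Qed.

Lemma v2is_eqmod k x y d : v2is k x -> x = y %[mod d] -> 2 ^ k.+1 %| d -> v2is k y.
Proof.
move=> vx e dd.
have H z : v2is k z <-> v2is k (z %% d).
  split=> h.
    by apply: (@v2isDr _ _ (z %/ d * d)); [rewrite addnC -divn_eq | apply: dvdn_mull].
  by rewrite (divn_eq z d) addnC; apply: v2isD => //; apply: dvdn_mull.
by apply: (H y).2; rewrite -e; apply: (H x).1.
Qed.

(** Lifting the exponent, by squaring: (1 + y)^2 = 1 + (2y + y^2), and since m > 1 makes y divisible
    by 4, y^2 does not disturb the valuation of 2y. *)
Lemma v2is_lift m u s j : 1 < m -> odd u -> v2is s j ->
  exists2 y, v2is (m + s) y & (1 + 2 ^ m * u) ^ j = 1 + y.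
Proof.
move=> m1 uu [o oo ->].
have E2 : 2 ^ m = 2 * 2 ^ m.-1 by rewrite -expnS prednK //; lia.
have base n : exists t, (1 + 2 ^ m * u) ^ n = 1 + 2 ^ m * u * n + 2 ^ m.+1 * t.
  elim: n => [|n [t IH]]; first by exists 0; ring.
  rewrite expnSr IH !expnS E2.
  by exists (t + 2 ^ m.-1 * u * u * n + t * 2 ^ m.-1 * 2 * u); ring.
elim: s => [|s [y [p op Ey] IH]].
  rewrite expn0 mul1n; have [t ->] := base o; rewrite addn0.
  exists (2 ^ m * u * o + 2 ^ m.+1 * t); last by ring.
  apply: v2isD; last exact: dvdn_mulr.
  by exists (u * o); rewrite ?oddM ?uu ?oo //; ring.
have -> : 2 ^ s.+1 * o = 2 ^ s * o * 2 by rewrite expnS; ring.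
rewrite expnM IH.
exists (2 * y + y ^ 2); last by ring.
rewrite Ey addnS.
apply: v2isD; first by exists p => //; rewrite expnS; ring.
apply/dvdnP; exists (2 ^ (m + s).-2 * p ^ 2).
by rewrite expnMn -expnM mulnAC -expnD; congr (2 ^ _ * _); lia.
Qed.

(* The exponent with A^(B^j) = A B^(cexp b j) C^j when B^[B,A] = B^b; in closed
   form cexp b j = j b^j - (b + ... + b^j). *)
Fixpoint cexp (b j : nat) : nat :=
  if j is i.+1 then b * (cexp b i + (b ^ i - 1)) else 0.

Lemma cexpS b j : cexp b j.+1 = b * (cexp b j + (b ^ j - 1)).
Proof. by []. Qed.

Lemma cexp_closed b j : 0 < b ->
  cexp b j * (b - 1) + b * (b ^ j - 1) = j * b ^ j * (b - 1).
Proof.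
case: b => // b _; rewrite subn1 /=; elim: j => [|j IH] /=.
  by rewrite expn0 subnn muln0.
have p : 0 < b.+1 ^ j by rewrite expn_gt0.
rewrite expnS; move: p IH; case: (b.+1 ^ j) => // z _.
have -> : z.+1 - 1 = z by rewrite subn1.
have -> : b.+1 * z.+1 - 1 = b * z.+1 + z by rewrite mulSn; lia.
move=> IH.
transitivity (b.+1 * (cexp b.+1 j * b + b.+1 * z) + b.+1 * b * z.+1); first by ring.
rewrite IH; ring.
Qed.

Lemma expn1D_quad w i : exists t, (1 + w) ^ i = 1 + i * w + w ^ 2 * t.
Proof.
elim: i => [|i [t IH]]; first by exists 0; ring.
by exists (i + t * (1 + w)); rewrite expnSr IH -addn1; ring.
Qed.

Lemma cexp_quad w j : exists t, cexp (1 + w) j = w * 'C(j, 2) + w ^ 2 * t.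
Proof.
elim: j => [|j [t IH]]; first by exists 0; rewrite /= bin0n !muln0.
have [s Es] := expn1D_quad w j.
exists (t + s + 'C(j, 2) + w * t + j + w * s).
rewrite cexpS IH Es -[1 + _ + _]addnA addKn binS bin1; ring.
Qed.

Lemma cexp_dvd b j : (b - 1) %| cexp b j.
Proof.
case: b => [|b]; first by elim: j => //= j _; rewrite mul0n.
rewrite subn1 /= -[b.+1]add1n; have [t ->] := cexp_quad b j.
by rewrite dvdn_add // ?dvdn_mulr //  dvdn_exp.
Qed.

(** This is what conjugating A by B^i and then by B^n yields. *)
Lemma cexpD b i n : 0 < b ->
  cexp b (i + n) = b ^ n * cexp b i + cexp b n + n * b ^ n * (b ^ i - 1).
Proof.
move=> b0; have H j : 0 < b ^ j by rewrite expn_gt0 b0.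
elim: n => [|n IH]; first by rewrite addn0 /=; ring.
rewrite addnS !cexpS IH expnS expnD; move: (H i) (H n).
case: (b ^ i) => // x _; case: (b ^ n) => // y _.
rewrite -[y.+1]addn1 -[x.+1]addn1 !addnK.
have -> : (x + 1) * (y + 1) - 1 = y * x + y + x by rewrite mulnDl !mulnDr; lia.
by rewrite -[n.+1]addn1; ring.
Qed.

Lemma cexp_double b j : 0 < b ->
  cexp b (2 * j) = (b ^ j + 1) * cexp b j + j * b ^ j * (b ^ j - 1).
Proof. by move=> b0; rewrite mul2n -addnn cexpD //; ring. Qed.

(** By doubling j. At s = 1 the term j b^j (b^j - 1) of [cexp_double] dominates; later it is (b^j +
    1) [cexp b j], where b^j + 1 is 2 modulo 4. Odd j are excluded: there the leading term (b - 1)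
    'C(j, 2) has no fixed valuation. *)
Lemma v2is_cexp m v s j : 1 < m -> odd v -> 0 < s -> v2is s j ->
  v2is (m + s).-1 (cexp (1 + 2 ^ m * v) j).
Proof.
move=> m1 vv; case: s => // s _ [o oo ->]; rewrite addnS /=.
set b := 1 + 2 ^ m * v.
have b0 : 0 < b by [].
elim: s => [|s IH].
  rewrite expn1 cexp_double // addn0.
  have [y vy ->] := v2is_lift m1 vv ((v2is_odd o).2 oo).
  rewrite addn0 in vy.
  rewrite [X in v2is _ X]addnC; apply: v2isD.
    rewrite addKn -[m]add0n; apply: v2isM => //; apply/v2is_odd.
    rewrite oddM oo oddD /=; case: vy => z _ ->.
    by rewrite oddM oddX /= orbF; case: (m) m1.
  rewrite -[m.+1]add1n expnD; apply: dvdn_mul.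
    case: vy => z _ ->; rewrite expn1 -addnA addnC -addnA dvdn_addl //.
    by apply: dvdn_mulr; apply: dvdn_exp => //; lia.
  apply: dvdn_trans (cexp_dvd _ _).
  by rewrite /b addKn; apply: dvdn_mulr.
rewrite expnS -mulnA cexp_double //.
have vj : v2is s.+1 (2 ^ s.+1 * o) by exists o.
have [y vy ->] := v2is_lift m1 vv vj.
apply: v2isD.
  rewrite addnS -add1n; apply: v2isM => //.
  apply: (@v2is_eqmod 1 2 _ 4) => //; first by exists 1.
  have /dvdnP[t ->] : 4 %| y.
    by apply: dvdn_trans (v2is_dvd vy); apply: (@dvdn_exp2l 2 2); lia.
  by rewrite addnAC addnC modnMDl.
rewrite addKn; case: vy => z _ ->.
rewrite [2 ^ _.+1]expnS; apply: dvdn_mul; last exact: dvdn_mulr.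
by rewrite expnS -!mulnA dvdn_mulr.
Qed.

(** The factor b is split off by one step of the recursion, which leaves the exponent b - 1 of
    valuation m. It has to be visible because conjugation by C^-1 sends A^(a n) to A^n. *)
Lemma v2is_cexp_self m v : 1 < m -> odd v ->
  exists2 x, v2is (2 * m).-1 x & cexp (1 + 2 ^ m * v) (1 + 2 ^ m * v) = (1 + 2 ^ m * v) * x.
Proof.
move=> m1 vv; rewrite {2}add1n cexpS.
set b := 1 + _; exists (cexp b (2 ^ m * v) + (b ^ (2 ^ m * v) - 1)) => //.
have vj : v2is m (2 ^ m * v) by exists v.
apply: v2isD.
  by rewrite mul2n -addnn; apply: v2is_cexp => //; lia.
have [y vy ->] := v2is_lift m1 vv vj; rewrite addKn.
by apply: dvdn_trans (v2is_dvd vy); apply: dvdn_exp2l; lia.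
Qed.

Lemma cexp_mul b r j : 0 < b ->
  cexp b (r * j) = cexp b j * \sum_(i < r) (b ^ j) ^ i + j * cexp (b ^ j) r.
Proof.
move=> b0; elim: r => [|r IH]; first by rewrite big_ord0 /= !muln0.
have -> : \sum_(i < r.+1) (b ^ j) ^ i = 1 + b ^ j * \sum_(i < r) (b ^ j) ^ i.
  by rewrite big_ord_recl big_distrr; congr (_ + _); apply: eq_bigr => i _; rewrite lift0 expnS.
rewrite mulSn addnC cexpD // IH /= [r * j]mulnC expnM; ring.
Qed.

(* This makes <A,C,B^(c^k)> a descending subnormal series for b - 1 = 2 c. *)
Lemma cexp_dvdX c k : c ^ k.+1 %| cexp (1 + 2 * c) (c ^ k).
Proof.
elim: k => [|k IH]; first by rewrite /= subnn addn0 muln0.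
have [z Ez] : exists z, (1 + 2 * c) ^ (c ^ k) = 1 + 2 * c * z.
  have [t ->] := expn1D_quad (2 * c) (c ^ k).
  by exists (c ^ k + 2 * c * t); ring.
have -> : c ^ k.+1 = c * c ^ k by rewrite expnS.
rewrite cexp_mul // Ez; apply: dvdn_add.
  rewrite expnS mulnC; apply: dvdn_mul => //.
  have E i : (1 + 2 * c * z) ^ i = 1 %[mod c].
    have -> : 1 + 2 * c * z = 2 * z * c + 1 by ring.
    by rewrite -modnXm modnMDl modnXm exp1n.
  rewrite /dvdn -modn_summ; under eq_bigr => i _ do rewrite E.
  by rewrite modn_summ sum1_card card_ord modnn.
have -> : c ^ k.+2 = c ^ k * (c * c) by rewrite !expnS; ring.
apply: dvdn_mul => //.
have [t ->] := cexp_quad (2 * c * z) c.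
apply: dvdn_add; last by apply/dvdnP; exists (4 * z ^ 2 * t); ring.
(* The 2 in [2 * c * z] clears the denominator of 'C(c, 2). This is why the series uses powers of
   (b-1)/2 and not of b-1. *)
apply/dvdnP; exists (z * c.-1).
rewrite bin2.
have := odd_double_half (c * c.-1); have -> : odd (c * c.-1) = false.
  by case: (c) => //= n; rewrite oddM oddS; case: odd.
rewrite -muln2 add0n; move: (_./2) => h E.
transitivity (c * z * (c * c.-1)); last by ring.
by rewrite -E; ring.
Qed.

(* Modulo q the hypothesis reads a (a^(a^k) - 1) = a^k a^(a^k) (a - 1), so if a <> 1 then
   a^k mod q is a function of a^k mod d, with d the order of a modulo q; hence k |-> a^k
   permutes Z/d, and being multiplicatively periodic it cannot reach 0 unless d = 1. *)
Lemma cexp_iter_prime q a : prime q -> 0 < a -> ~~ (q %| a) ->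
  (forall k, q %| cexp a (a ^ k)) -> q %| a - 1.
Proof.
move=> qp a0 qa H.
pose x : 'F_q := (a%:R)%R.
have x0 : x != 0%R by rewrite /x -(dvdn_pcharf (pchar_Fp qp)).
have subE n : 0 < n -> ((n - 1)%:R = n%:R - 1 :> 'F_q)%R by move=> n0; rewrite natrB.
rewrite (dvdn_pcharf (pchar_Fp qp)) subE // subr_eq0; apply/negPn/negP => x1.
have key k : (x * (x ^+ (a ^ k) - 1) = x ^+ k * x ^+ (a ^ k) * (x - 1))%R.
  have := congr1 (fun n => n%:R%R : 'F_q) (cexp_closed (a ^ k) a0).
  have -> : ((cexp a (a ^ k) * (a - 1) + a * (a ^ a ^ k - 1))%:R =
     (a%:R * (a ^ a ^ k - 1)%:R) :> 'F_q)%R.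
    rewrite natrD natrM; have /eqP -> : ((cexp a (a ^ k))%:R == 0 :> 'F_q)%R.
      by rewrite -(dvdn_pcharf (pchar_Fp qp)).
    by rewrite mul0r add0r natrM.
  by rewrite !natrM !subE ?expn_gt0 ?a0 // !natrX.
have ux : (x \is a GRing.unit)%R by rewrite unitfE.
pose u : {unit 'F_q} := FinRing.unit 'F_q ux.
have valX n : (val (u ^+ n)%g = x ^+ n)%R by rewrite FinRing.val_unitX.
have eqX i j : (x ^+ i == x ^+ j)%R = (i == j %[mod #[u]%g]).
  by rewrite -!valX (inj_eq val_inj) eq_expg_mod_order.
have d0 : 0 < #[u]%g by apply: order_gt0.
pose f (i : 'I_#[u]%g) := Ordinal (ltn_pmod (a ^ i) d0).
have inj_f : injective f.
  move=> i j /(congr1 val) /= /eqP e; apply/val_inj.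
  have /eqP E : (x ^+ (a ^ i) == x ^+ (a ^ j))%R by rewrite eqX.
  have := key i; rewrite E key => /(mulIf _); rewrite subr_eq0 => /(_ x1).
  move/(mulIf (expf_neq0 _ x0))/eqP; rewrite eqX => /eqP.
  by rewrite !modn_small.
have [g fg gf] := injF_bij inj_f.
(* Surjectivity gives k with a^k = 0 modulo the order; then a^(k+1) is 0 as well, and comparing
   [key] at k and k+1 gives x^(k+1) = x^k. *)
have := congr1 val (gf (Ordinal d0)) => /= e.
set k : nat := g _ in e.
have /eqP E : (x ^+ (a ^ k.+1) == x ^+ (a ^ k))%R.
  by rewrite eqX expnS -modnMmr e muln0 mod0n.
have := key k; rewrite -E key => /(mulIf _); rewrite subr_eq0 => /(_ x1).
move/(mulIf (expf_neq0 _ x0)); rewrite exprS -{2}[(x ^+ k)%R]mul1r.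
by move/(mulIf (expf_neq0 _ x0))/eqP; apply/negP.
Qed.

Local Open Scope group_scope.

(** * Consequences of the relations *)

Lemma conjXX (gT : finGroupType) (x y : gT) a n k :
  x ^ y = x ^+ a -> (x ^+ n) ^ (y ^+ k) = x ^+ (n * a ^ k).
Proof.
move=> e; elim: k => [|k IH]; first by rewrite conjg1 expn0 muln1.
by rewrite expgSr conjgM IH conjXg e -expgM expnS mulnCA mulnA.
Qed.

Lemma mulXX (gT : finGroupType) (x y : gT) a n k :
  x ^ y = x ^+ a -> x ^+ n * y ^+ k = y ^+ k * x ^+ (n * a ^ k).
Proof. by move=> e; rewrite -(conjXX _ _ e) conjgE !mulgA mulgV mul1g. Qed.

(* The exponents g with (x y)^n = y^n x^g satisfy cexp a n + g = n a^n. *)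
Lemma expMg_cexp (gT : finGroupType) (x y : gT) a n :
  0 < a -> x ^ y = x ^+ a -> (x * y) ^+ n * x ^+ cexp a n = x ^+ n * y ^+ n.
Proof.
move=> a0 e; elim: n => [|n IH]; first by rewrite !mulg1.
have p : 0 < a ^ n by rewrite expn_gt0 a0.
rewrite expgSr cexpS [x ^+ n.+1]expgSr [y ^+ n.+1]expgSr -[RHS]mulgA.
have -> : x * (y ^+ n * y) = y ^+ n * (x ^+ (a ^ n) * y).
  by rewrite !mulgA -{1}[x]expg1 (mulXX _ _ e) mul1n.
rewrite [RHS]mulgA -IH -!mulgA; congr (_ * _).
have -> : x * (y * x ^+ (a * (cexp a n + (a ^ n - 1)))) = x ^+ cexp a n * x ^+ (a ^ n) * y.
  have -> : y * x ^+ (a * (cexp a n + (a ^ n - 1))) = x ^+ (cexp a n + (a ^ n - 1)) * y.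
    by have := mulXX (cexp a n + (a ^ n - 1)) 1 e; rewrite !expg1 expn1 mulnC => ->.
  rewrite mulgA -expgS -expgD; congr (x ^+ _ * _); lia.
by rewrite !mulgA.
Qed.

(** The relations with natural exponents: in a finite group alpha and beta only matter modulo a
    multiple of the element orders. The pair of conditions is symmetric in (a, A) and (b, B), so
    each consequence comes in two versions. *)
Definition mac (a b : nat) (gT : finGroupType) (A B : gT) : Prop :=
  A ^ [~ A, B] = A ^+ a /\ B ^ [~ B, A] = B ^+ b.

Section Mac.
Variables (a b : nat) (gT : finGroupType) (A B : gT).
Hypothesis M : mac a b A B.
Let C := [~ A, B].

Lemma mac_sym : mac b a B A. Proof. by case: M. Qed.

Lemma mac_AC : A ^ C = A ^+ a. Proof. by case: M. Qed.

Lemma mac_conjBV : B ^ C^-1 = B ^+ b. Proof. by case: M => _; rewrite invg_comm. Qed.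

Lemma mac_CB k n : C ^+ k * B ^+ n = B ^+ (n * b ^ k) * C ^+ k.
Proof.
have := mulXX n k mac_conjBV; rewrite expVgn => e.
apply: (mulgI (C ^- k)); rewrite !mulgA mulVg mul1g -e.
by rewrite mulgKV.
Qed.

Lemma mac_AB : A ^ B = A * C. Proof. by rewrite conjg_mulR. Qed.

Hypothesis b0 : 0 < b.

Lemma mac_conjCB k : (C ^+ k) ^ B = B ^+ (b ^ k - 1) * C ^+ k.
Proof.
have p : 0 < b ^ k by rewrite expn_gt0 b0.
have := mac_CB k 1; rewrite expg1 mul1n conjgE => ->.
by rewrite -{1}(subnK p) addn1 expgS -mulgA mulKg.
Qed.

Lemma mac_conjA_powB j : A ^ (B ^+ j) = A * B ^+ cexp b j * C ^+ j.
Proof.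
elim: j => [|j IH]; first by rewrite conjg1 !mulg1.
have BB : B ^ B = B by rewrite conjgE mulKg.
rewrite expgSr conjgM IH !conjMg mac_AB mac_conjCB conjXg BB cexpS expgS.
have := mac_CB 1 (cexp b j + (b ^ j - 1)); rewrite expg1 expn1 mulnC expgD => E.
rewrite -/C; move: (C) E => c E.
by rewrite -!mulgA; congr (_ * _); rewrite !mulgA -E !mulgA.
Qed.

Lemma mac_conjC_powB j : C ^ (B ^+ j) = B ^+ ((b - 1) * j) * C.
Proof.
elim: j => [|j IH]; first by rewrite conjg1 muln0 mul1g.
rewrite expgSr conjgM IH conjMg conjXg.
have -> : B ^ B = B by rewrite conjgE mulKg.
have := mac_conjCB 1; rewrite !expg1 expn1 => ->.
by rewrite mulgA -expgD mulnS addnC.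
Qed.

End Mac.

Lemma mac_conjB_powA a b (gT : finGroupType) (A B : gT) j : mac a b A B -> 0 < a ->
  B ^ (A ^+ j) = B * A ^+ cexp a j * [~ A, B] ^- j.
Proof.
by move=> /mac_sym M a0; rewrite (mac_conjA_powB M a0) -(invg_comm A B) expVgn.
Qed.

Lemma mac_commCA a b (gT : finGroupType) (A B : gT) n : mac a b A B -> 0 < a ->
  [~ [~ A, B] ^+ n, A] = A ^- (a ^ n - 1).
Proof.
move=> M a0; have := conjXX 1 n (mac_AC M); rewrite expg1 mul1n; set C := [~ A, B] => e.
have p : 0 < a ^ n by rewrite expn_gt0 a0.
have -> : [~ C ^+ n, A] = (A ^ (C ^+ n))^-1 * A by rewrite /commg !conjgE !invMg invgK !mulgA.
by rewrite e -{1}(subnKC p) add1n expgS invMg -mulgA mulVg mulg1.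
Qed.

Lemma mac_commCB a b (gT : finGroupType) (A B : gT) n : mac a b A B -> 0 < b ->
  [~ [~ A, B] ^+ n, B] = (B ^+ (b ^ n - 1)) ^ ([~ A, B] ^+ n).
Proof. by move=> M b0; rewrite commgEl (mac_conjCB M b0) [RHS]conjgE. Qed.

Lemma mac_commAB a b (gT : finGroupType) (A B : gT) n : mac a b A B -> 0 < a ->
  [~ A ^+ n, B] = [~ A, B] ^+ n * A ^- cexp a n.
Proof.
move=> M a0; have := expMg_cexp n a0 (mac_AC M) => e.
by rewrite commgEl conjXg mac_AB (canRL (mulgK _) e) -mulgA mulKg.
Qed.

(* Both sides of B^(C^k A) = B^(A^(a^k) C^k) can be computed. *)
Lemma mac_cexp_iter a b (gT : finGroupType) (A B : gT) k : mac a b A B -> 0 < a ->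
  A ^+ cexp a (a ^ k) \in <<[set B; [~ A, B]]>>.
Proof.
move=> M a0; set C := [~ A, B]; set H := <<_>>.
have HB : B \in H by rewrite mem_gen // set21.
have HC : C \in H by rewrite mem_gen // set22.
have E : A ^+ (a ^ k) = A ^ (C ^+ k).
  by have := conjXX 1 k (mac_AC M); rewrite expg1 mul1n => ->.
have BA : B ^ A \in H by rewrite conjg_mulR -(invg_comm A B) groupMl // groupV.
have BAk : B ^ (A ^+ (a ^ k)) \in H.
  rewrite E [A ^ _]conjgE !conjgM groupJ ?groupX //.
  have /cycleP[n ->] : B ^ C ^- k \in <[B]>.
    by have := conjXX 1 k (mac_conjBV M); rewrite expg1 expVgn => ->; apply: mem_cycle.
  by rewrite conjXg groupX.
move: BAk; rewrite (mac_conjB_powA _ M a0) groupMr; last by rewrite groupV groupX.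
by rewrite groupMl.
Qed.

(* The power Q of A of order q lies in <B,C>; if q did not divide a - 1 then Q would be a
   commutator [Q',C] in there, hence in <B>, hence central in <A,B>. *)
Lemma mac_prime_order a b (gT : finGroupType) (A B : gT) q : mac a b A B -> 0 < a ->
  prime q -> q %| #[A] -> q %| a - 1.
Proof.
move=> M a0 qp qA; set C := [~ A, B].
have q0 := prime_gt0 qp.
have AC := mac_AC M; rewrite -/C in AC.
pose Q := A ^+ (#[A] %/ q).
have oQ : #[Q] = q by rewrite orderXdiv ?dvdn_div // ?divnA // ?mulKn //; apply: order_gt0.
have QC : Q ^ C = Q ^+ a by rewrite /Q conjXg AC -!expgM mulnC.
have qa : ~~ (q %| a).
  apply/negP => qa; have : #[Q ^ C] = 1%N.
    by rewrite QC; apply/eqP; rewrite order_eq1 -order_dvdn oQ.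
  by rewrite orderJ oQ => q1; rewrite q1 in qp.
apply/negPn/negP => qa1.
have gen n : ~~ (q %| n) -> exists u, Q = Q ^+ n ^+ u.
  rewrite -prime_coprime // -oQ => co; exists (expg_invn <[Q]> n).
  by rewrite (expgK co) ?cycle_id.
pose H := <<[set B; C]>>.
have QH : Q \in H.
  apply/negPn/negP => QnH; move/negP: qa1; apply.
  apply: cexp_iter_prime => // k; apply: contraR QnH => /gen[u ->].
  by rewrite groupX // -expgM mulnC expgM groupX // (mac_cexp_iter _ M).
have nBC : <[C]> \subset 'N(<[B]>).
  rewrite cycle_subG -groupV; apply/normP/eqP; rewrite eqEcard cardJg leqnn andbT.
  by rewrite -cycleJ cycle_subG (mac_conjBV M) mem_cycle.
have /mulsgP[x y /cycleP[i ->] /cycleP[j ->] EQ] : Q \in <[B]> * <[C]>.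
  by rewrite -norm_joinEr // joing_idl joing_idr.
have QB : Q \in <[B]>.
  have [u ->] := gen _ qa1; apply: groupX.
  have -> : Q ^+ (a - 1) = Q ^ C * Q^-1.
    by rewrite QC -{2}(subnK a0) addn1 expgSr mulgK.
  rewrite EQ conjMg; have -> : (C ^+ j) ^ C = C ^+ j by rewrite conjXg conjgE mulKg.
  rewrite invMg mulgA mulgK groupM ?groupV ?mem_cycle //.
  by rewrite memJ_norm ?mem_cycle // -cycle_subG.
have cQ : Q ^ C = Q.
  apply/conjg_fixP/commgP/cent1P; rewrite cent1C groupR //; apply/cent1P.
    exact: commuteX.
  by have [k ->] := cycleP _ _ QB; apply: commuteX.
move/negP: qa1; apply; rewrite -oQ order_dvdn; apply/eqP/(mulgI Q).
by rewrite -expgS -addn1 subnK // -QC cQ mulg1.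
Qed.

(** * Nilpotency *)

Lemma dvdn_expn_primes n c : 0 < n -> 0 < c ->
  (forall q, prime q -> q %| n -> q %| c) -> n %| c ^ n.
Proof.
move=> n0 c0 H; apply/(dvdn_partP _ n0) => q; rewrite mem_primes => /and3P[qp _ qn].
rewrite p_part; apply: dvdn_trans (dvdn_exp2r _ (H _ qp qn)) _.
by apply: dvdn_exp2l; apply/ltnW/ltn_logl.
Qed.

Lemma Fitting_subnormal (gT : finGroupType) (G N : {group gT}) :
  N <| G -> 'F(N) \subset 'F(G).
Proof.
move=> nN; apply: Fitting_max (Fitting_nil _).
exact: char_normal_trans (Fitting_char _) nN.
Qed.

Lemma mac_Fitting a c (gT : finGroupType) (A B : gT) :
  mac a (1 + 2 * c) A B -> 0 < a -> 0 < c -> ~~ odd c ->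
  A \in 'F(<<[set A; B]>>).
Proof.
set b := (1 + 2 * c)%N => M a0 c0 cev; set C := [~ A, B].
have b0 : 0 < b by [].
have Eb : (b - 1 = 2 * c)%N by rewrite /b addKn.
pose H k := <<A |: [set C; B ^+ (c ^ k)]>>%G.
have HA k : A \in H k by rewrite mem_gen // !inE eqxx.
have HC k : C \in H k by rewrite mem_gen // !inE eqxx orbT.
have HB k n : c ^ k %| n -> B ^+ n \in H k.
  case/dvdnP => t ->; rewrite mulnC expgM groupX //.
  by rewrite mem_gen // !inE eqxx !orbT.
have nH k : H k.+1 <| H k.
  have sH : H k.+1 \subset H k.
    rewrite gen_subG; apply/subsetP => x; rewrite !inE => /or3P[] /eqP-> //.
    by rewrite HB // dvdn_exp2l.
  rewrite /normal sH /= gen_subG; apply/subsetP => x.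
  rewrite !inE => /or3P[] /eqP->.
  - by rewrite (conjGid (HA k.+1)).
  - by rewrite (conjGid (HC k.+1)).
  rewrite -genJ gen_subG.
  apply/subsetP => y /imsetP[z zH ->]; change (z ^ B ^+ (c ^ k) \in H k.+1).
  move: zH; rewrite !inE => /or3P[] /eqP->.
  - by rewrite (mac_conjA_powB M b0) groupM ?(groupX _ (HC _)) // groupM // HB // cexp_dvdX.
  - rewrite (mac_conjC_powB M b0) groupM // HB // Eb mulnAC -mulnA -expnSr.
    exact: dvdn_mull.
  - have BB : B ^ (B ^+ (c ^ k)) = B by rewrite conjgE -expgS expgSr mulKg.
    by rewrite conjXg BB HB.
have [K EK] : exists K, B ^+ (c ^ K) = 1.
  (* Every prime dividing o(B) divides b - 1 = 2c, hence c, as c is even. *)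
  exists #[B]; apply/eqP; rewrite -order_dvdn; apply: dvdn_expn_primes => // q qp qB.
  have := mac_prime_order (mac_sym M) b0 qp qB; rewrite Eb Euclid_dvdM //.
  by case/orP => //; rewrite dvdn_prime2 // => /eqP->; rewrite dvdn2.
have nA : <[A]> <| H K.
  rewrite /normal cycle_subG HA gen_subG; apply/subsetP => x.
  rewrite EK !inE => /or3P[] /eqP->; rewrite -cycleJ cycle_subG.
  - by rewrite conjgE mulKg cycle_id.
  - by rewrite (mac_AC M) mem_cycle.
  - by rewrite conjg1 cycle_id.
(* Induction climbs from [H K] to [H 0]; past k = K the truncated difference stays 0. *)
have FA k : A \in 'F(H (K - k)).
  elim: k => [|k IH].
    rewrite subn0; apply: (subsetP (Fitting_max nA (abelian_nil (cycle_abelian A)))).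
    exact: cycle_id.
  case: (ltnP k K) => kK; last first.
    by move: IH; have -> : (K - k = K - k.+1)%N by lia.
  apply: (subsetP (Fitting_subnormal (nH _))).
  by have <- : (K - k = (K - k.+1).+1)%N by lia.
have := FA K; rewrite subnn; congr (_ \in 'F(_)); apply/eqP.
rewrite eqEsubset !gen_subG; apply/andP; split; apply/subsetP => x.
  have gA : A \in <<[set A; B]>> by rewrite mem_gen // set21.
  have gB : B \in <<[set A; B]>> by rewrite mem_gen // set22.
  by rewrite !inE => /or3P[] /eqP->; rewrite ?groupR ?groupX.
by rewrite !inE => /orP[] /eqP-> //; rewrite -[B]expg1; apply: HB.
Qed.

Lemma mac_nilpotent a c (gT : finGroupType) (A B : gT) :
  mac (1 + 2 * a) (1 + 2 * c) A B -> 0 < a -> 0 < c -> ~~ odd a -> ~~ odd c ->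
  nilpotent <<[set A; B]>>.
Proof.
move=> M a0 c0 oa oc; set G := <<_>>.
suff sG : G \subset 'F(G) by apply: nilpotentS sG (Fitting_nil _).
rewrite gen_subG; apply/subsetP => x; rewrite !inE => /orP[] /eqP->.
  exact: mac_Fitting M _ c0 oc.
rewrite /G setUC; exact: mac_Fitting (mac_sym M) _ a0 oa.
Qed.

(** * Relations in the Sylow 2-subgroup *)

Lemma odd_inv_mod n K : odd n -> exists2 l, odd l & n * l = 1 %[mod 2 ^ K].
Proof.
(* The modulus 2^(K+1) forces the inverse to be odd even when K = 0. *)
move=> on; have co : coprime n (2 ^ K.+1) by rewrite coprimeXr // coprimen2.
have p : 0 < n by apply: odd_gt0.
have [[l k] /= E] := coprimeP _ p co.
have E' : (l * n = 1 + k * 2 ^ K.+1)%N by lia.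
exists l; last by rewrite mulnC E' expnS mulnA addnC modnMDl.
by have := congr1 odd E'; rewrite oddM on andbT oddD oddM oddX /= andbF.
Qed.

Lemma two_elt_exp (gT : finGroupType) (x : gT) : 2.-elt x -> exists K, x ^+ (2 ^ K) = 1.
Proof. by case/p_natP => K E; exists K; rewrite -E expg_order. Qed.

Lemma two_elt_odd_inv (gT : finGroupType) (x : gT) n : 2.-elt x -> odd n ->
  exists2 l, odd l & x ^+ (n * l) = x.
Proof.
case/p_natP => K E on; have [l ol e] := odd_inv_mod K on; exists l => //.
by rewrite -{2}[x]expg1; apply/eqP; rewrite eq_expg_mod_order E; apply/eqP.
Qed.

(** Odd factors of an exponent are invertible modulo the order of a 2-element, so only the valuation
    counts. *)
Lemma cycleX_v2is (gT : finGroupType) (x : gT) k n : 2.-elt x -> v2is k n ->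
  <[x ^+ n]> = <[x ^+ (2 ^ k)]>.
Proof.
move=> x2 [o oo ->]; apply/eqP; rewrite eqEsubset !cycle_subG; apply/andP; split.
  by rewrite expgM mem_cycle.
have [l ol E] := two_elt_odd_inv x2 oo.
by rewrite -{1}E -expgM mulnC mulnA expgM mem_cycle.
Qed.

Lemma expg_v2is1 (gT : finGroupType) (x : gT) k n : 2.-elt x -> v2is k n ->
  (x ^+ n == 1) = (x ^+ (2 ^ k) == 1).
Proof. by move=> x2 kn; rewrite -!order_eq1 !orderE (cycleX_v2is x2 kn). Qed.

Lemma expg_dvd1 (gT : finGroupType) (x : gT) n k : x ^+ n = 1 -> n %| k -> x ^+ k = 1.
Proof. by move=> e /dvdnP[t ->]; rewrite mulnC expgM e expg1n. Qed.

Lemma order_two_elt_sq (gT : finGroupType) (x : gT) : 2.-elt x -> x != 1 ->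
  #[x ^+ 2] < #[x].
Proof.
case/p_natP => -[|K] E x1; first by rewrite -order_eq1 E in x1.
rewrite orderXdiv ?E ?expnS ?dvdn_mulr // mulKn //.
by rewrite ltn_Pmull // expn_gt0.
Qed.

(* Exponents only matter modulo the order, so that v2(a - b) = 2m - 1 is encoded by the last
   condition, which is symmetric in A and B. *)
Definition mac2 (m a b : nat) (gT : finGroupType) (A B : gT) : Prop :=
  [/\ mac a b A B, v2is m (a - 1), v2is m (b - 1), [/\ 2.-elt A, 2.-elt B & 2.-elt [~ A, B]]
    & exists2 w, odd w & [~ A, B] ^+ a = [~ A, B] ^+ (b + 2 ^ (2 * m - 1) * w)].

Lemma mac2_sym m a b (gT : finGroupType) (A B : gT) : mac2 m a b A B -> mac2 m b a B A.
Proof.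
case=> M va vb [A2 B2 C2] [w ow E]; split=> //; first exact: mac_sym.
  by split; rewrite // -invg_comm /p_elt orderV.
have [K EK] := two_elt_exp C2.
(* An odd natural number representing -w modulo the order of C. *)
exists (w * (2 ^ K.+1 - 1))%N.
  by rewrite oddM ow oddB ?expn_gt0 // oddX.
rewrite -invg_comm !expVgn; congr (_^-1).
rewrite [RHS]expgD E -expgD -addnA -mulnDr.
have -> : (w + w * (2 ^ K.+1 - 1) = w * (2 * 2 ^ K))%N.
  by rewrite -expnS mulnBr muln1 subnKC // leq_pmulr // expn_gt0.
by rewrite expgD [X in _ * X](expg_dvd1 EK) ?mulg1 // !mulnA dvdn_mull.
Qed.

Section Mac2.
Variables (m a b : nat) (gT : finGroupType) (A B : gT).
Hypotheses (m1 : 1 < m) (M2 : mac2 m a b A B).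

Lemma mac2_gt0 : 0 < a.
Proof. by case: M2 => _ /v2is_gt0; rewrite subn_gt0 => /ltnW. Qed.

Lemma mac2_odd : odd a.
Proof.
case: M2 => _ /v2is_dvd + _ _ _; case: (m) m1 => // n _; rewrite expnS => /dvdnP[t e].
by rewrite -(subnKC mac2_gt0) e oddD !oddM /= andbF.
Qed.

Lemma mac2_lift s j : v2is s j -> exists2 y, v2is (m + s) y & (a ^ j)%N = (1 + y)%N.
Proof.
case: M2 => _ [u ou Eu] _ _ _; move/(v2is_lift m1 ou) => [y vy E].
by exists y => //; rewrite -E -Eu subnKC // mac2_gt0.
Qed.

Lemma mac2_cexp s j : 0 < s -> v2is s j -> v2is (m + s).-1 (cexp a j).
Proof.
case: M2 => _ [u ou Eu] _ _ _ s0; move/(v2is_cexp m1 ou s0).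
by rewrite -Eu subnKC // mac2_gt0.
Qed.

Lemma mac2_cexp_self : exists2 x, v2is (2 * m - 1) x & cexp a a = (a * x)%N.
Proof.
case: M2 => _ [u ou Eu] _ _ _; have := v2is_cexp_self m1 ou.
by rewrite -Eu subnKC ?mac2_gt0 // subn1.
Qed.

End Mac2.

Section Mac2Relations.
Variables (m a b : nat) (gT : finGroupType) (A B : gT).
Hypotheses (m1 : 1 < m) (M2 : mac2 m a b A B).
Let C := [~ A, B].
Let N := (2 ^ (2 * m - 1))%N.
Let a0 := mac2_gt0 M2.
Let b0 := mac2_gt0 (mac2_sym M2).

Lemma mac2_BA_CX : exists i j w,
  [/\ v2is (2 * m - 1) i, v2is (2 * m - 1) j, odd w, B ^+ i * A ^+ j = C ^+ (N * w)
    & i = cexp b b].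
Proof.
case: (M2) => M va vb [A2 B2 C2] [w ow Ew].
have [y vy Ey] := mac2_cexp_self m1 (mac2_sym M2).
have [x vx Ex] := mac2_cexp_self m1 M2.
have AC := mac_AC M; rewrite -/C in AC.
have ob : odd b := mac2_odd m1 (mac2_sym M2).
have oab : odd (a ^ b) by rewrite oddX (mac2_odd m1 M2) orbT.
have [l ol El] := two_elt_odd_inv A2 oab.
exists (b * y)%N, (x * l)%N, w; split => //.
- by rewrite -[(2 * m - 1)%N]add0n; apply: v2isM => //; apply/v2is_odd.
- by rewrite -[(2 * m - 1)%N]addn0; apply: v2isM => //; apply/v2is_odd.
rewrite -Ey.
(* Uses (A^a)^B = (A C)^a and [expMg_cexp]. Afterwards A^x is moved left past C^b, which divides its
   exponent by a^b; this is the role of [l]. *)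
have E0 : A * B ^+ cexp b b * C ^+ b * A ^+ x = A * C ^+ a.
  rewrite -(mac_conjA_powB M b0) -(mac_conjBV M) -/C.
  have AxC n : (A ^+ (a * n)) ^ C^-1 = A ^+ n.
    by rewrite expgM -AC -conjXg conjgK.
  have -> : A ^ (B ^ C^-1) = ((A ^ C) ^ B) ^ C^-1.
    by rewrite [B ^ _]conjgE invgK !conjgM.
  rewrite AC [(A ^+ a) ^ B]conjXg (mac_AB A B) -/C.
  rewrite -(AxC x) -conjMg -Ex expMg_cexp // conjMg -{1}[a]muln1 AxC expg1.
  by rewrite conjXg [C ^ _]conjgE invgK mulgV mulg1.
move: E0; rewrite -!mulgA => /mulgI; rewrite Ew expgD => E0.
have Cx : C ^+ b * A ^+ x = A ^+ (x * l) * C ^+ b.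
  by rewrite (mulXX _ _ AC) -mulnA [(l * _)%N]mulnC mulnC expgM El.
move: E0; rewrite Cx mulgA -[C ^+ b * _]expgD addnC expgD.
by move/mulIg.
Qed.

(** Conjugate A by B^i, with i from [mac2_BA_CX]. Directly this gives A B^(cexp b i) C^i; through
    B^i = C^(N w) A^-j it gives a power A^(1 + y), with y of valuation m + (2m-1). *)
Lemma mac2_BC_AX : exists i k l,
  [/\ v2is (3 * m - 2) i, v2is (2 * m - 1) k, v2is (3 * m - 1) l & B ^+ i * C ^+ k = A ^+ l].
Proof.
have [i [j [w [vi vj ow R Ei]]]] := mac2_BA_CX.
case: (M2) => M va vb [A2 B2 C2] _.
have vNw : v2is (2 * m - 1) (N * w) by exists w.
have [y vy Ey] := mac2_lift m1 M2 vNw.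
have p : 0 < 2 * m - 1 by lia.
exists (cexp b i), i, y; split => //.
- by have := mac2_cexp m1 (mac2_sym M2) p vi; congr (v2is _ _); lia.
- by move: vy; congr (v2is _ _); lia.
have := mac_conjA_powB M b0 i.
have -> : B ^+ i = C ^+ (N * w) * A ^- j by rewrite -R mulgK.
have := conjXX 1 (N * w) (mac_AC M); rewrite expg1 mul1n -/C => E.
rewrite conjgM E Ey conjXg conjgE invgK.
have -> : A ^+ j * (A * A ^- j) = A by rewrite mulgA -expgSr expgS mulgK.
by rewrite expgS -mulgA => /mulgI ->.
Qed.

End Mac2Relations.

Lemma cycleI_comm (gT : finGroupType) (A B x : gT) :
  x \in <[A]> -> x \in <[B]> -> x ^ [~ A, B] = x.
Proof.
case/cycleP => i Ei /cycleP[j Ej]; apply/conjg_fixP/commgP/cent1P; rewrite cent1C groupR //.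
  by apply/cent1P; rewrite Ei; apply: commuteX.
by apply/cent1P; rewrite Ej; apply: commuteX.
Qed.

(** In B^i C^k = A^l, conjugation by C^-1 shows that D = B^(i(b-1)) lies in both <A> and <B>, so C
    centralises D. Conjugating back by C then gives D A^(l(a-1)) = 1, with exponents of valuation
    4m-2 for B and 4m-1 for A. *)
Lemma mac2_cycle_eq m a b (gT : finGroupType) (A B : gT) : 1 < m -> mac2 m a b A B ->
  <[B ^+ (2 ^ (4 * m - 2))]> = <[A ^+ (2 ^ (4 * m - 1))]>.
Proof.
move=> m1 M2; have a0 := mac2_gt0 M2; have b0 := mac2_gt0 (mac2_sym M2); pose C := [~ A, B].
have [i [k [l [vi vk vl E1]]]] := mac2_BC_AX m1 M2.
case: (M2) => M va vb [A2 B2 C2] _.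
have AC := mac_AC M; rewrite -/C in AC.
have vib : v2is (4 * m - 2) (i * (b - 1)).
  by have := v2isM vi vb; congr (v2is _ _); lia.
have vla : v2is (4 * m - 1) (l * (a - 1)).
  by have := v2isM vl va; congr (v2is _ _); lia.
pose D := B ^+ (i * (b - 1)).
have ED : D * A ^+ l = (A ^+ l) ^ C^-1.
  rewrite -E1 conjMg [in RHS]conjXg (mac_conjBV M) conjXg.
  have -> : [~ A, B] ^ C^-1 = [~ A, B] by rewrite -/C conjgE invgK mulgV mulg1.
  rewrite mulgA -!expgM -expgD; congr (B ^+ _ * _).
  by rewrite mulnBr muln1 subnK 1?mulnC // leq_pmull.
have DA : D \in <[A]>.
  have -> : D = (A ^+ l) ^ C^-1 * A ^- l by rewrite -ED mulgK.
  rewrite groupM ?groupV ?mem_cycle // memJ_norm ?mem_cycle // groupV.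
  apply/normP/eqP; rewrite eqEcard cardJg leqnn andbT.
  by rewrite -cycleJ cycle_subG AC mem_cycle.
have DC : D ^ C = D by apply: cycleI_comm => //; apply: mem_cycle.
have E2 : D * A ^+ (l * (a - 1)) = 1.
  have := congr1 (conjg^~ C) ED; rewrite conjMg DC conjgKV conjXg AC -expgM.
  rewrite -{1}(subnK a0) mulnC mulnDr muln1 expgD mulgA.
  by move=> /(canRL (mulgK _)); rewrite mulgV.
rewrite -(cycleX_v2is B2 vib) -(cycleX_v2is A2 vla) -/D.
by rewrite -cycleV; congr <[_]>; apply/eqP; rewrite eq_invg_mul E2.
Qed.

(** By [mac2_cycle_eq] and its mirror image, A^(2^(4m-2)) generates a subgroup of the group
    generated by its own square, so it is trivial. *)
Lemma mac2_expA_weak m a b (gT : finGroupType) (A B : gT) : 1 < m -> mac2 m a b A B ->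
  A ^+ (2 ^ (4 * m - 2)) = 1.
Proof.
move=> m1 M2.
case: (M2) => M va vb [A2 B2 C2] _.
have E1 := mac2_cycle_eq m1 M2; have E2 := mac2_cycle_eq m1 (mac2_sym M2).
have e : (4 * m - 1 = (4 * m - 2).+1)%N by lia.
have X x : x ^+ (2 ^ (4 * m - 1)) = (x ^+ (2 ^ (4 * m - 2))) ^+ 2 :> gT.
  by rewrite -expgM e expnSr.
apply/eqP/negPn/negP => n1.
have := order_two_elt_sq (p_eltX _ A2) n1.
rewrite -X !orderE E2 -E1 X -!orderE ltnNge; case/negP.
by apply: dvdn_leq; [apply: order_gt0 | apply: orderXdvd].
Qed.

(** With the high powers gone, conjugating A by B^l = A^i C^-k (the mirrored relation) collapses to
    C^l = A^-y, where l and y both have valuation 3m-1. It remains to kill C^(2^(3m-1)), which is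
    the 2^m-th power of the unmirrored relation: there A^l1 and C^k1 commute. *)
Lemma mac2_expA m a b (gT : finGroupType) (A B : gT) : 1 < m -> mac2 m a b A B ->
  A ^+ (2 ^ (3 * m - 1)) = 1.
Proof.
move=> m1 M2; have b0 := mac2_gt0 (mac2_sym M2); pose C := [~ A, B].
case: (M2) => M va vb [A2 B2 C2] _.
have AC := mac_AC M; rewrite -/C in AC.
have A4 := mac2_expA_weak m1 M2; have B4 := mac2_expA_weak m1 (mac2_sym M2).
have dvd2 j n : j <= n -> 2 ^ j %| 2 ^ n by apply: dvdn_exp2l.
have [l C3 Cl] : exists2 l, C ^+ (2 ^ (3 * m - 1)) = 1 & v2is (3 * m - 1) l /\
    exists2 y, v2is (3 * m - 1) y & C ^+ l = A ^- y.
  have [i [k [l [vi vk vl E2]]]] := mac2_BC_AX m1 (mac2_sym M2).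
  rewrite -invg_comm -/C in E2; exists l; last first.
    split=> //; have [y vy Ey] := mac2_lift m1 M2 vk; exists y.
      by move: vy; congr (v2is _ _); lia.
    have := mac_conjA_powB M b0 l; rewrite -E2 expVgn conjgM -/C.
    have -> : A ^ (A ^+ i) = A by rewrite conjgE -expgS expgSr mulKg.
    have p : 0 < 3 * m - 1 by lia.
    rewrite (expg_dvd1 B4) ?mulg1; last first.
      apply: dvdn_trans (v2is_dvd (mac2_cexp m1 (mac2_sym M2) p vl)).
      by apply: dvd2; lia.
    move/(congr1 (conjg^~ (C ^+ k))); rewrite -conjgM mulVg conjg1 conjMg.
    have -> : (C ^+ l) ^ (C ^+ k) = C ^+ l.
      by rewrite conjgE -expgD addnC expgD mulKg.
    have := conjXX 1 k AC; rewrite expg1 mul1n => ->; rewrite Ey expgS -mulgA.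
    by rewrite -{1}[A]mulg1 => /mulgI/esym/eqP; rewrite -eq_invg_mul => /eqP.
  have [i1 [k1 [l1 [vi1 vk1 vl1 E1]]]] := mac2_BC_AX m1 M2; rewrite -/C in E1.
  have v3 : v2is (3 * m - 1) (k1 * 2 ^ m).
    by have := v2isM vk1 (v2isX2 m); congr (v2is _ _); lia.
  apply/eqP; rewrite -(expg_v2is1 C2 v3).
  have [y vy Ey] := mac2_lift m1 M2 vk1.
  have Com : commute (A ^+ l1) (C ^+ k1).
    apply/commgP/conjg_fixP; rewrite (conjXX _ _ AC) Ey mulnDr muln1 expgD.
    rewrite [X in _ * X](expg_dvd1 A4) ?mulg1 //.
    by apply: dvdn_trans (v2is_dvd (v2isM vl1 vy)); apply: dvd2; lia.
  have : (A ^+ l1 * C ^- k1) ^+ (2 ^ m) = 1.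
    rewrite -E1 mulgK -expgM (expg_dvd1 B4) //.
    by apply: dvdn_trans (v2is_dvd (v2isM vi1 (v2isX2 m))); apply: dvd2; lia.
  rewrite expgMn; last exact: commuteV.
  rewrite -expgM (expg_dvd1 A4) ?mul1g.
    by rewrite expVgn -expgM => /eqP; rewrite invg_eq1.
  by apply: dvdn_trans (v2is_dvd (v2isM vl1 (v2isX2 m))); apply: dvd2; lia.
case: Cl => vl [y vy E]; apply/eqP; rewrite -(expg_v2is1 A2 vy) -invg_eq1 -E.
by rewrite (expg_v2is1 C2 vl) C3.
Qed.

Lemma expg_inv2 (gT : finGroupType) (x : gT) j : x ^+ (2 ^ j.+1) = 1 -> x ^- (2 ^ j) = x ^+ (2 ^ j).
Proof. by move=> e; apply/eqP; rewrite eq_invg_mul -expgD addnn -mul2n -expnS e. Qed.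

(** In B^i C^k = A^l the right side is now 1, and the square of B^i is 1, so signs and odd factors
    of the exponents disappear. *)
Lemma mac2_CN_B m a b (gT : finGroupType) (A B : gT) : 1 < m -> mac2 m a b A B ->
  [~ A, B] ^+ (2 ^ (2 * m - 1)) = B ^+ (2 ^ (3 * m - 2)).
Proof.
move=> m1 M2; pose C := [~ A, B]; rewrite -/C.
case: (M2) => M va vb [A2 B2 C2] _.
have A3 := mac2_expA m1 M2; have B3 := mac2_expA m1 (mac2_sym M2).
have [i [k [l [vi vk vl E1]]]] := mac2_BC_AX m1 M2; rewrite -/C in E1.
move: E1; rewrite [X in _ = X](expg_dvd1 A3) ?(v2is_dvd vl) // => E1.
have e3 : (3 * m - 1 = (3 * m - 2).+1)%N by lia.
have odd_pow (x : gT) j o : x ^+ (2 ^ j.+1) = 1 -> odd o -> x ^+ (2 ^ j * o) = x ^+ (2 ^ j).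
  move=> e oo; rewrite -(odd_double_half o) oo mulnDr muln1 expgD.
  rewrite -mul2n mulnA -expnSr expgM.
  by rewrite e expg1n mulg1.
have Ei : B ^+ i = B ^+ (2 ^ (3 * m - 2)).
  by case: vi => o oo ->; apply: odd_pow => //; rewrite -e3.
have Ck : C ^+ k = B ^+ (2 ^ (3 * m - 2)).
  apply/(mulgI (B ^+ i)); rewrite E1 Ei -expgD addnn -mul2n -expnS -e3 B3 //.
have C2N : C ^+ (2 ^ (2 * m - 1).+1) = 1.
  have vk2 : v2is (2 * m - 1).+1 (k * 2) by rewrite -addn1; apply: (v2isM vk (v2isX2 1)).
  apply/eqP; rewrite -(expg_v2is1 C2 vk2) expgM Ck -expgM -expnSr -e3 B3 //.
by rewrite -Ck; case: vk => o oo ->; rewrite odd_pow.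
Qed.

(** The mirror image replaces C by C^-1, which is harmless because C^(2N) = 1. *)
Lemma mac2_CN_A m a b (gT : finGroupType) (A B : gT) : 1 < m -> mac2 m a b A B ->
  [~ A, B] ^+ (2 ^ (2 * m - 1)) = A ^+ (2 ^ (3 * m - 2)).
Proof.
move=> m1 M2.
rewrite -(mac2_CN_B m1 (mac2_sym M2)) -(invg_comm A B) expVgn expg_inv2 //.
rewrite expnSr expgM (mac2_CN_B m1 M2) -expgM -expnSr.
have <- : (3 * m - 1 = (3 * m - 2).+1)%N by lia.
exact: mac2_expA m1 (mac2_sym M2).
Qed.

Lemma mac2_cycleN m a b (gT : finGroupType) (A B : gT) : 1 < m -> mac2 m a b A B ->
  <[A ^+ (2 ^ (2 * m - 1))]> = <[B ^+ (2 ^ (2 * m - 1))]>.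
Proof.
move=> m1 M2.
case: (M2) => M va vb [A2 B2 C2] _.
have [i [j [w [vi vj ow R Ei]]]] := mac2_BA_CX m1 M2.
have A3 := mac2_expA m1 M2.
rewrite expgM (mac2_CN_A m1 M2) in R.
(* The factor 2^(3m-1) - 1 stands for -1. As 3m-2 >= 2m, the second summand does not change the
   valuation 2m-1 of the exponent. *)
have E : B ^+ i = A ^+ (j * (2 ^ (3 * m - 1) - 1) + 2 ^ (3 * m - 2) * w).
  apply: (mulIg (A ^+ j)); rewrite R -expgM -expgD addnAC -[X in (_ + X + _)%N]muln1.
  rewrite -mulnDr subnK ?expn_gt0 // expgD [X in _ = X * _](expg_dvd1 A3) ?mul1g //.
  exact: dvdn_mull.
rewrite -(cycleX_v2is B2 vi) E; apply/esym/cycleX_v2is => //.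
apply: v2isD.
  rewrite -[(2 * m - 1)%N]addn0; apply: v2isM => //; apply/v2is_odd.
  by rewrite oddB ?expn_gt0 // oddX orbF; case: (m) m1 => // n; rewrite mulnS.
by apply: dvdn_mulr; apply: dvdn_exp2l; lia.
Qed.

(** * Order and class *)

Lemma norm_gen (gT : finGroupType) (X : {set gT}) x :
  {in X, forall y, y ^ x \in <<X>>} -> x \in 'N(<<X>>).
Proof.
move=> H; rewrite inE -genJ gen_subG; apply/subsetP => y /imsetP[z zX ->].
exact: H.
Qed.

Lemma card_genU1 (gT : finGroupType) (X : {set gT}) x n : 0 < n ->
  {in X, forall y, y ^ x \in <<X>>} -> x ^+ n \in <<X>> ->
  #|<<X :|: [set x]>>| <= n * #|<<X>>|.
Proof.
move=> n0 /norm_gen nx xn; set H := <<X>>%G.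
have -> : <<X :|: [set x]>> = H * <[x]>.
  by rewrite -norm_joinEr ?cycle_subG //= joing_idl joing_idr.
have sI : <[x ^+ n]> \subset H :&: <[x]>.
  by rewrite subsetI !cycle_subG xn mem_cycle.
have I0 : 0 < #|H :&: <[x]>| by apply: cardG_gt0.
rewrite -(leq_pmul2r I0) -mul_cardG -mulnA mulnCA leq_pmul2l ?cardG_gt0 //.
apply: leq_trans (leq_mul (leqnn n) (subset_leq_card sI)).
rewrite -!orderE orderXgcd -{1}(divnK (dvdn_gcdl #[x] n)) mulnC leq_mul2r.
by rewrite dvdn_leq ?orbT // dvdn_gcdr.
Qed.

(** Modulo H the two sets of generators centralise each other, hence so do the subgroups they
    generate. *)
Lemma commg_gen_sub (gT : finGroupType) (X Y : {set gT}) (H : {group gT}) :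
  X \subset 'N(H) -> Y \subset 'N(H) ->
  {in X & Y, forall x y, [~ x, y] \in H} -> [~: <<X>>, <<Y>>] \subset H.
Proof.
move=> nX nY c; rewrite -quotient_cents2 ?gen_subG // !quotient_gen //.
rewrite gen_subG centsC gen_subG centsC.
rewrite quotient_cents2 // gen_subG; apply/subsetP => _ /imset2P[x y xX yY ->].
exact: c.
Qed.

Section Upper.
Variables (m a b : nat) (gT : finGroupType) (A B : gT).
Hypotheses (m1 : 1 < m) (M2 : mac2 m a b A B).
Let C := [~ A, B].
Let N := (2 ^ (2 * m - 1))%N.
Let a0 := mac2_gt0 M2.
Let b0 := mac2_gt0 (mac2_sym M2).
Let y := B ^+ (2 ^ m).

Lemma mac2_BN_A k : N %| k -> B ^+ k \in <[A ^+ N]>.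
Proof. by case/dvdnP => t ->; rewrite mulnC expgM (mac2_cycleN m1 M2) mem_cycle. Qed.

Lemma mac2_AN k : N %| k -> A ^+ k \in <[A ^+ N]>.
Proof. by case/dvdnP => t ->; rewrite mulnC expgM mem_cycle. Qed.

Lemma mac2_cexpN : N %| cexp b (2 ^ m).
Proof.
have p : 0 < m by clear -m1; lia.
apply: dvdn_trans (v2is_dvd (mac2_cexp m1 (mac2_sym M2) p (v2isX2 m))).
by apply: dvdn_exp2l; clear -m1; lia.
Qed.

Lemma mac2_card : #|<<[set A; B]>>| <= 2 ^ (7 * m - 3).
Proof.
case: (M2) => M va vb [A2 B2 C2] _.
have AC := mac_AC M; rewrite -/C in AC.
have p2 n : 0 < 2 ^ n by rewrite expn_gt0.
have sN k X : N %| k -> A \in <<X>> -> B ^+ k \in <<X>>.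
  move=> /mac2_BN_A h AX; apply: (subsetP _ _ h).
  by rewrite cycle_subG groupX.
have c1 : #|<<[set A]>>| <= 2 ^ (3 * m - 1).
  by apply: dvdn_leq => //; rewrite -orderE order_dvdn (mac2_expA m1 M2).
have c2 : #|<<[set A; C]>>| <= N * #|<<[set A]>>|.
  apply: card_genU1; [exact: p2 | | by rewrite (mac2_CN_A m1 M2) mem_cycle].
  by move=> x; rewrite inE => /eqP->; rewrite AC mem_cycle.
(* The index is at most 2^(m-1) because y^(2^(m-1)) = B^N already lies in <A>. *)
have c3 : #|<<[set A; C; y]>>| <= 2 ^ m.-1 * #|<<[set A; C]>>|.
  have gA : A \in <<[set A; C]>> by rewrite mem_gen ?set21.
  have gC : C \in <<[set A; C]>> by rewrite mem_gen ?set22.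
  apply: card_genU1 => //.
    move=> x; rewrite !inE => /orP[] /eqP->.
      rewrite (mac_conjA_powB M b0) groupM ?(groupX _ gC) // groupM //.
      by apply: sN => //; apply: mac2_cexpN.
    rewrite (mac_conjC_powB M b0) groupM //; apply: sN => //.
    have := v2is_dvd (v2isM vb (v2isX2 m)); apply: dvdn_trans.
    by apply: dvdn_exp2l; clear -m1; lia.
  by rewrite -expgM; apply: sN => //; rewrite -expnD; apply: dvdn_exp2l; clear -m1; lia.
have c4 : #|<<[set A; C; y] :|: [set B]>>| <= 2 ^ m * #|<<[set A; C; y]>>|.
  have gA : A \in <<[set A; C; y]>> by rewrite mem_gen // !inE eqxx.
  have gC : C \in <<[set A; C; y]>> by rewrite mem_gen // !inE eqxx orbT.
  have gy : y \in <<[set A; C; y]>> by rewrite mem_gen // !inE eqxx orbT.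
  have BB n : (B ^+ n) ^ B = B ^+ n by rewrite conjXg conjgE mulKg.
  apply: card_genU1 => // x; rewrite !inE => /orP[/orP[]|] /eqP->.
  - by rewrite mac_AB groupM.
  - have := mac_conjCB M b0 1; rewrite !expg1 expn1 -/C => ->.
    have /dvdnP[t ->] := v2is_dvd vb.
    by rewrite groupM // mulnC expgM groupX.
  - by rewrite BB.
apply: leq_trans (subset_leq_card (genS _)) _.
  2: apply: leq_trans c4 _.
  by apply/subsetP => x; rewrite !inE => /orP[] ->; rewrite ?orbT.
apply: leq_trans (leq_mul (leqnn _) c3) _.
apply: leq_trans (leq_mul (leqnn _) (leq_mul (leqnn _) c2)) _.
apply: leq_trans (leq_mul (leqnn _) (leq_mul (leqnn _) (leq_mul (leqnn _) c1))) _.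
by rewrite -!expnD; apply: leq_pexp2l => //; clear -m1; lia.
Qed.

Lemma mac2_dvd_exp k n : v2is n k -> 2 ^ (m + n) %| a ^ k - 1.
Proof. by case/(mac2_lift m1 M2) => z vz ->; rewrite addKn; apply: v2is_dvd. Qed.

(** An explicit commutator survives: from C, bracketing with A, B, A in turn gives, up to inverses,
    A^(a-1), then C^(a-1) times a power of A, then A^z with v2(z) = 2m. *)
Lemma mac2_lcn5_neq1 : A ^+ (2 ^ (2 * m)) != 1 -> 'L_5(<<[set A; B]>>) != 1.
Proof.
case: (M2) => M va vb [A2 B2 C2] _ An1; pose P := <<[set A; B]>>%G.
change ('L_5(P) != 1).
have PA : A \in P by rewrite mem_gen ?set21.
have PB : B \in P by rewrite mem_gen ?set22.
have L2 : C \in 'L_2(P) by rewrite lcnSn mem_commg.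
have L3 : A ^+ (a - 1) \in 'L_3(P).
  have : A ^- (a - 1) \in 'L_3(P).
    by have := mac_commCA 1 M a0; rewrite expg1 expn1 => <-; rewrite lcnSn mem_commg.
  by rewrite groupV.
have L4 : C ^+ (a - 1) * A ^- cexp a (a - 1) \in 'L_4(P).
  by rewrite -(mac_commAB _ M a0) lcnSn mem_commg.
have [z vz Ez] := mac2_lift m1 M2 va.
have L5 : A ^- z \in 'L_5(P).
  have <- : [~ C ^+ (a - 1) * A ^- cexp a (a - 1), A] = A ^- z.
    have := mac_commCA (a - 1) M a0; rewrite Ez addKn => <-.
    rewrite commMgJ; have -> : [~ A ^- cexp a (a - 1), A] = 1.
      by apply/eqP/commgP/commute_sym/commuteV/commuteX.
    rewrite mulg1; apply/conjg_fixP/commgP; rewrite (mac_commCA _ M a0).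
    by apply/commuteV/commute_sym/commuteV/commuteX2.
  by rewrite lcnSn mem_commg.
apply: contra An1 => /eqP L1; move: L5; rewrite L1 => /set1P/eqP.
have vz' : v2is (2 * m) z by move: vz; congr (v2is _ _); clear -m1; lia.
by rewrite invg_eq1 (expg_v2is1 A2 vz').
Qed.

Lemma mac2_lcn6 : 'L_6(<<[set A; B]>>) = 1.
Proof.
case: (M2) => M va vb [A2 B2 C2] _; pose P := <<[set A; B]>>%G.
change ('L_6(P) = 1).
have PA : A \in P by rewrite mem_gen ?set21.
have PB : B \in P by rewrite mem_gen ?set22.
have PC : C \in P by rewrite groupR.
(* [H2] to [H5] contain the corresponding lower central terms. They are treated from the bottom up,
   because [step] needs a normal target, and normality of H follows from [H, P] <= K <= H one level
   below. *)
pose H5 := <<[set A ^+ (2 ^ (2 * m))]>>%G.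
pose H4 := <<[set C ^+ (2 ^ m); A ^+ N]>>%G.
pose H3 := <<[set A ^+ (2 ^ m); B ^+ (2 ^ m); C ^+ (2 ^ m)]>>%G.
pose H2 := <<[set A ^+ (2 ^ m); B ^+ (2 ^ m); C]>>%G.
have step (X : {set gT}) (H : {group gT}) : P \subset 'N(H) -> X \subset P ->
  {in X, forall x, [~ x, A] \in H /\ [~ x, B] \in H} -> [~: <<X>>, P] \subset H.
  move=> nH sX h; apply: commg_gen_sub => [||x z xX].
  - exact: subset_trans sX nH.
  - by apply: subset_trans nH; apply: subset_gen.
  - by case: (h _ xX) => h1 h2; rewrite !inE => /orP[] /eqP->.
have norm (H K : {group gT}) : [~: H, P] \subset K -> K \subset H -> P \subset 'N(H).
  by move=> h1 h2; rewrite -commg_subl; apply: subset_trans h1 h2.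
have AA k : [~ A ^+ k, A] = 1 by apply/eqP/commgP/commute_sym/commuteX.
have BB k : [~ B ^+ k, B] = 1 by apply/eqP/commgP/commute_sym/commuteX.
have AB k : N %| k -> [~ A ^+ k, B] = 1.
  move/mac2_AN; rewrite (mac2_cycleN m1 M2) => /cycleP[j ->].
  by rewrite -expgM BB.
have e2 : (2 * m = (2 * m - 1).+1)%N by clear -m1; lia.
have dN j : 2 * m - 1 <= j -> N %| 2 ^ j by apply: dvdn_exp2l.
have A5 k : 2 ^ (2 * m) %| k -> A ^+ k \in H5.
  by case/dvdnP => t ->; rewrite mulnC expgM groupX // mem_gen // inE.
have B5 k : 2 ^ (2 * m) %| k -> B ^+ k \in H5.
  case/dvdnP => t ->; rewrite mulnC expgM groupX // e2 expnSr expgM.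
  have /cycleP[j ->] : B ^+ N \in <[A ^+ N]> by apply: mac2_BN_A.
  by rewrite -!expgM A5 // {1}e2 expnSr mulnCA dvdn_mull.
have c5 : [~ C ^+ (2 ^ m), A] \in H5 /\ [~ C ^+ (2 ^ m), B] ^ C ^- (2 ^ m) \in H5.
  rewrite (mac_commCA _ M a0) (mac_commCB _ M b0) conjgK groupV; split.
    apply: A5; apply: dvdn_trans (mac2_dvd_exp (v2isX2 m)).
    by apply: dvdn_exp2l; rewrite mul2n addnn.
  apply: B5; have [z vz ->] := mac2_lift m1 (mac2_sym M2) (v2isX2 m); rewrite addKn.
  by apply: dvdn_trans (v2is_dvd vz); apply: dvdn_exp2l; rewrite mul2n addnn.
have s5 : [~: H5, P] \subset [1 gT].
  apply: (step _ 1%G); rewrite ?norms1 ?sub1set ?groupX // => x; rewrite inE => /eqP->.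
  by rewrite AA AB ?group1 // dN // leq_subr.
have n5 : P \subset 'N(H5) by apply: norm s5 (sub1G _).
have CB5 k (H : {group gT}) :
    P \subset 'N(H) -> [~ C ^+ k, B] ^ C ^- k \in H -> [~ C ^+ k, B] \in H.
  by move=> nH; rewrite memJ_norm // groupV (subsetP nH) // groupX.
have c45 : [~ C ^+ (2 ^ m), A] \in H5 /\ [~ C ^+ (2 ^ m), B] \in H5.
  by case: c5 => h1 h2; split => //; apply: CB5.
have s4 : [~: H4, P] \subset H5.
  apply: step => // [|x].
    by apply/subsetP => x; rewrite !inE => /orP[] /eqP->; rewrite groupX.
  by rewrite !inE => /orP[] /eqP-> //; rewrite AA AB ?group1.
have H54 : H5 \subset H4.
  rewrite gen_subG sub1set e2 expnSr expgM groupX // mem_gen //.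
  by rewrite !inE eqxx orbT.
have n4 : P \subset 'N(H4) by apply: norm s4 H54.
have HN4 : <[A ^+ N]> \subset H4 by rewrite cycle_subG mem_gen // !inE eqxx orbT.
have HC4 : C ^+ (2 ^ m) \in H4 by rewrite mem_gen // !inE eqxx.
have cA : [~ A ^+ (2 ^ m), A] \in H4 /\ [~ A ^+ (2 ^ m), B] \in H4.
  rewrite AA group1; split => //; rewrite (mac_commAB _ M a0) groupM ?groupV //.
  apply: (subsetP HN4); apply: mac2_AN.
  apply: dvdn_trans (v2is_dvd (mac2_cexp m1 M2 (ltnW m1) (v2isX2 m))).
  by apply: dN; rewrite subn1 mul2n addnn.
have cB : [~ B ^+ (2 ^ m), A] \in H4 /\ [~ B ^+ (2 ^ m), B] \in H4.
  rewrite BB group1; split => //.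
  rewrite (mac_commAB _ (mac_sym M) b0) -invg_comm groupM ?groupV //.
    by rewrite expVgn groupV.
  by apply: (subsetP HN4); apply: mac2_BN_A; apply: mac2_cexpN.
have s3 : [~: H3, P] \subset H4.
  apply: step => // [|x].
    by apply/subsetP => x; rewrite !inE => /orP[/orP[]|] /eqP->; rewrite groupX.
  rewrite !inE => /orP[/orP[]|] /eqP-> //.
  by split; apply: (subsetP H54); case: c45.
have H43 : H4 \subset H3.
  rewrite gen_subG; apply/subsetP => x; rewrite !inE => /orP[] /eqP->.
    by rewrite mem_gen // !inE eqxx !orbT.
  have -> : N = (2 ^ m * 2 ^ (m - 1))%N by rewrite -expnD /N; congr (2 ^ _)%N; clear -m1; lia.
  by rewrite expgM groupX // mem_gen // !inE eqxx.
have n3 : P \subset 'N(H3) by apply: norm s3 H43.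
have s2 : [~: H2, P] \subset H3.
  apply: step => // [|x].
    by apply/subsetP => x; rewrite !inE => /orP[/orP[]|] /eqP->; rewrite ?groupX.
  rewrite !inE => /orP[/orP[]|] /eqP->.
  - by split; apply: (subsetP H43); case: cA.
  - by split; apply: (subsetP H43); case: cB.
  split.
    have := mac_commCA 1 M a0; rewrite expg1 expn1 => ->; rewrite groupV.
    have /dvdnP[t ->] := v2is_dvd va; rewrite mulnC expgM groupX // mem_gen //.
    by rewrite !inE eqxx.
  have := CB5 1%N H3 n3; rewrite (mac_commCB _ M b0) conjgK expg1 expn1; apply.
  have /dvdnP[t ->] := v2is_dvd vb; rewrite mulnC expgM groupX // mem_gen //.
  by rewrite !inE eqxx orbT.
have H32 : H3 \subset H2.
  rewrite gen_subG; apply/subsetP => x; rewrite !inE => /orP[/orP[]|] /eqP->.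
  - by rewrite mem_gen // !inE eqxx.
  - by rewrite mem_gen // !inE eqxx orbT.
  - by rewrite groupX // mem_gen // !inE eqxx !orbT.
have n2 : P \subset 'N(H2) by apply: norm s2 H32.
have CH2 : C \in H2 by rewrite mem_gen // !inE eqxx !orbT.
have s1 : [~: P, P] \subset H2.
  apply: step => // [|x]; first exact: subset_gen.
  rewrite !inE => /orP[] /eqP->; rewrite commgg group1; split=> //.
  by rewrite -invg_comm groupV.
have -> : 'L_6(P) = [~: [~: [~: [~: [~: P, P], P], P], P], P] by [].
apply/trivgP; apply: subset_trans s5; apply: commSg; apply: subset_trans s4; apply: commSg.
by apply: subset_trans s3; apply: commSg; apply: subset_trans s2; apply: commSg.
Qed.
End Upper.

(** * Cyclic extensions *)

(** The classical data of a cyclic extension. Bijectivity of [cext_aut] is implied, since a positive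
    iterate is an inner automorphism. *)
Record cext_data (gT : finGroupType) := CextData {
  cext_aut : gT -> gT;
  cext_pow : gT;
  cext_idx : nat;
  cext_autM : {morph cext_aut : x y / x * y};
  cext_aut_pow : cext_aut cext_pow = cext_pow;
  cext_iter : forall x, iter cext_idx cext_aut x = x ^ cext_pow;
  cext_idx_gt0 : 0 < cext_idx }.

(* The pair (i, g) stands for t^i g, where t is a new element with t^n = k and
   g^t = s g. *)
Definition cext (gT : finGroupType) (d : cext_data gT) : Type :=
  ('I_(cext_idx d) * gT)%type.

Section Cext.
Variables (gT : finGroupType) (d : cext_data gT).
Let s := cext_aut d.
Let k := cext_pow d.
Let n := cext_idx d.
Let n0 : 0 < n := cext_idx_gt0 d.

HB.instance Definition _ := Finite.on (cext d).

(** Accepts any natural exponent of t and carries the quotient by n into a power of k, so that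
    products of normal forms need no case distinction on overflow. *)
Definition cext_elt i (g : gT) : cext d := (Ordinal (ltn_pmod i n0), k ^+ (i %/ n) * g).
Definition cext_mul (x y : cext d) : cext d :=
  cext_elt (x.1 + y.1) (iter y.1 s x.2 * y.2).
Definition cext_inv (x : cext d) : cext d :=
  cext_elt (n - x.1) (iter (n - x.1) s (x.2^-1 * k^-1)).

Lemma cext_eltE (x : cext d) : x = cext_elt x.1 x.2.
Proof.
case: x => i g; rewrite /cext_elt /= divn_small // expg0 mul1g; congr pair.
by apply/val_inj; rewrite /= modn_small.
Qed.

Lemma iterM j : {morph iter j s : x y / x * y}.
Proof. by move=> x y; elim: j => //= j ->; apply: cext_autM. Qed.

Lemma iter_pow j i : iter j s (k ^+ i) = k ^+ i.
Proof.
elim: j => //= j ->; elim: i => [|i IH]; last first.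
  by rewrite expgS [s _]cext_autM -/s IH [s _]cext_aut_pow.
by apply: (mulgI (s 1)); rewrite -[s 1 * s _]cext_autM !mulg1.
Qed.

Lemma iter_mod j g : iter j s g = iter (j %% n) s g ^ (k ^+ (j %/ n)).
Proof.
have H q : iter (q * n) s g = g ^ (k ^+ q).
  elim: q => [|q IH]; first by rewrite conjg1.
  by rewrite mulSn iterD IH [iter n s _]cext_iter expgSr conjgM.
rewrite {1}(divn_eq j n) addnC iterD H.
by rewrite !conjgE -expgVn !iterM iter_pow; congr (_ * _); apply: (mulgI (k ^+ (j %/ n)));
  rewrite expgVn mulgV -{1}(iter_pow (j %% n) (j %/ n)) -iterM mulgV; exact: (iter_pow _ 0).
Qed.

Lemma cext_mulE i j g h :
  cext_mul (cext_elt i g) (cext_elt j h) = cext_elt (i + j) (iter j s g * h).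
Proof.
rewrite /cext_mul /cext_elt /=; congr pair; first by apply/val_inj; rewrite /= modnDm.
have -> : ((i + j) %/ n = i %/ n + j %/ n + (i %% n + j %% n) %/ n)%N.
  rewrite {1}(divn_eq i n) {1}(divn_eq j n) addnACA -mulnDl divnMDl //.
rewrite iterM iter_pow [iter j s g]iter_mod conjgE addnC !expgD.
set x := k ^+ (i %/ n); set y := k ^+ (j %/ n); set z := iter _ _ _; set w := k ^+ _.
have c (u v : nat) : commute (k ^+ u) (k ^+ v) by apply: commuteX2.
have yw : y * w = w * y by apply: c.
have xw : x * w = w * x by apply: c.
by rewrite -(mulgA x y w) yw (mulgA x) xw -!mulgA; do 2!congr (_ * _); rewrite mulKVg.
Qed.

Lemma cext_mulA : associative cext_mul.
Proof.
move=> x y z; rewrite [x]cext_eltE [y]cext_eltE [z]cext_eltE !cext_mulE.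
by rewrite iterM -iterD addnA [(z.1 + y.1)%N]addnC mulgA.
Qed.

Lemma cext_mul1 : left_id (cext_elt 0 1) cext_mul.
Proof.
by move=> x; rewrite {1}[x]cext_eltE cext_mulE add0n (iter_pow _ 0) mul1g -cext_eltE.
Qed.

Lemma cext_mulV : left_inverse (cext_elt 0 1) cext_inv cext_mul.
Proof.
move=> x; rewrite {2}[x]cext_eltE cext_mulE subnK; last exact/ltnW.
rewrite -iterD subnKC; last exact/ltnW.
rewrite [iter n s _]cext_iter /cext_elt; congr pair.
  by apply/val_inj; rewrite /= modnn mod0n.
by rewrite divnn n0 div0n !conjgE expg1 mulg1 !mulgA mulgV mul1g mulgKV mulVg.
Qed.

HB.instance Definition _ :=
  Finite_isGroup.Build (cext d) cext_mulA cext_mul1 cext_mulV.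

Lemma cext_eltM i j g h :
  cext_elt i g * cext_elt j h = cext_elt (i + j) (iter j s g * h).
Proof. exact: cext_mulE. Qed.

Lemma cext_eltX j : cext_elt 1 1 ^+ j = cext_elt j 1.
Proof.
elim: j => // j IH; rewrite expgSr IH cext_eltM addn1.
by rewrite (iter_pow 1 0) mulg1.
Qed.
End Cext.

(** The last clause drives the iteration: it produces the endomorphism for the next extension from
    images of generators that satisfy the relations. *)
Lemma cyclic_ext (gT : finGroupType) (s : gT -> gT) (k : gT) n : 0 < n ->
  {morph s : x y / x * y} -> s k = k -> (forall x, iter n s x = x ^ k) ->
  exists (E : finGroupType) (i : gT -> E) (t : E),
  [/\ injective i /\ {morph i : x y / x * y}, (forall x, i x ^ t = i (s x)) /\ t ^+ n = i k,
      #|E| = (n * #|gT|)%N, forall z, exists j x, z = t ^+ j * i x &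
      forall (hT : finGroupType) (f : gT -> hT) (y : hT),
        {morph f : u v / u * v} -> (forall x, f x ^ y = f (s x)) -> y ^+ n = f k ->
        exists F : E -> hT, [/\ {morph F : u v / u * v}, forall x, F (i x) = f x & F t = y]].
Proof.
move=> n0 sM sk sn; pose d := CextData sM sk sn n0.
exists (cext d), (cext_elt d 0), (cext_elt d 1 1).
have i0 g : cext_elt d 0 g = (Ordinal n0, g).
  by rewrite /cext_elt div0n mul1g; congr pair; apply/val_inj; rewrite /= mod0n.
split.
- split=> [x y | x y]; first by rewrite !i0 => -[].
  by rewrite cext_eltM.
- split=> [x|]; first apply: (mulgI (cext_elt d 1 1)).
    by rewrite conjgE mulgA mulgV mul1g !cext_eltM /= mulg1 mul1g.
  rewrite cext_eltX /cext_elt /= divnn n0 mulg1 div0n mul1g; congr pair.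
  by apply/val_inj; rewrite /= modnn mod0n.
- by rewrite card_prod card_ord.
- move=> z; exists z.1, z.2; rewrite cext_eltX cext_eltM addn0 /= mul1g.
  exact: cext_eltE.
move=> hT f y fM fy yn.
have f1 : f 1 = 1 by apply: (mulgI (f 1)); rewrite -fM !mulg1.
have fX x j : f (x ^+ j) = f x ^+ j.
  by elim: j => // j IH; rewrite !expgS fM IH.
have fi j x : f (iter j s x) = f x ^ (y ^+ j).
  by elim: j => [|j IH]; rewrite ?conjg1 //= -fy IH -conjgM -expgSr.
pose F (z : cext d) := y ^+ z.1 * f z.2.
have FE j g : F (cext_elt d j g) = y ^+ j * f g.
  rewrite /F /= fM fX -yn mulgA -expgM -expgD; congr (y ^+ _ * _).
  by rewrite {3}(divn_eq j n) mulnC addnC.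
exists F; split.
- move=> u v; rewrite [u]cext_eltE [v]cext_eltE cext_eltM !FE fM fi expgD conjgE.
  by rewrite -!mulgA; congr (_ * _); rewrite mulKVg.
- by move=> x; rewrite FE mul1g.
- by rewrite FE f1 mulg1 expg1.
Qed.

(** * A group of order 2^(7m-3) *)

Section MorphFun.
Variables (gT hT : finGroupType) (f : gT -> hT).
Hypothesis fM : {morph f : x y / x * y}.

Lemma morphf1 : f 1 = 1.
Proof. by apply: (mulgI (f 1)); rewrite -fM !mulg1. Qed.

Lemma morphfX n : {morph f : x / x ^+ n}.
Proof. by move=> x; elim: n => [|n IH]; rewrite ?morphf1 // !expgS fM IH. Qed.

Lemma morphfV : {morph f : x / x^-1}.
Proof. by move=> x; apply: (mulgI (f x)); rewrite -fM !mulgV morphf1. Qed.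

Lemma morphfJ : {morph f : x y / x ^ y}.
Proof. by move=> x y; rewrite !conjgE !fM morphfV. Qed.
End MorphFun.

Lemma iter_morph (gT : finGroupType) (s : gT -> gT) j :
  {morph s : x y / x * y} -> {morph iter j s : x y / x * y}.
Proof. by move=> sM x y; elim: j => //= j ->; apply: sM. Qed.

Lemma cyclic_model n : 0 < n -> exists (E : finGroupType) (t : E),
  [/\ #|E| = n, t ^+ n = 1, forall z, exists j, z = t ^+ j &
      forall (hT : finGroupType) (y : hT), y ^+ n = 1 ->
        exists F : E -> hT, {morph F : u v / u * v} /\ F t = y].
Proof.
(* ['S_0] serves as the trivial group, of which a cyclic group is a cyclic extension. *)
move=> n0; have S1 (x : 'S_0) : x = 1 by apply/permP; case.
have [|||E [i [t [[_ iM] [_ tn] cE gE UP]]]] := @cyclic_ext _ (@id 'S_0) 1 n n0.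
- by [].
- by [].
- by move=> x; rewrite !(S1 x) (S1 (iter _ _ _)) conjg1.
exists E, t; split.
- by rewrite cE card_Sn muln1.
- by rewrite tn (morphf1 iM).
- by move=> z; have [j [x ->]] := gE z; exists j; rewrite (S1 x) (morphf1 iM) mulg1.
move=> hT y yn; have [|||F [FM _ Ft]] := UP hT (fun _ => 1) y.
- by move=> u v; rewrite mulg1.
- by move=> x; rewrite conj1g.
- by [].
by exists F.
Qed.

Definition rel_AC (m a : nat) (gT : finGroupType) (A C : gT) : Prop :=
  [/\ A ^ C = A ^+ a, A ^+ (2 ^ (3 * m - 1)) = 1
    & C ^+ (2 ^ (2 * m - 1)) = A ^+ (2 ^ (3 * m - 2))].

Lemma model_AC m a : 1 < m -> v2is m (a - 1) -> 
  exists (E : finGroupType) (A C : E),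
  [/\ rel_AC m a A C, A ^+ (2 ^ (3 * m - 2)) != 1,
      #|E| = (2 ^ (2 * m - 1) * 2 ^ (3 * m - 1))%N,
      forall z, exists j i, z = C ^+ j * A ^+ i &
      forall (hT : finGroupType) (x y : hT), rel_AC m a x y ->
        exists F : E -> hT, [/\ {morph F : u v / u * v}, F A = x & F C = y]].
Proof.
move=> m1 va; have p2 j : 0 < 2 ^ j by rewrite expn_gt0.
have [Z [t [cZ tn gZ UPZ]]] := cyclic_model (p2 (3 * m - 1)).
have a0 : 0 < a by have := v2is_gt0 va; rewrite subn_gt0 => /ltnW.
have ot : #[t] = (2 ^ (3 * m - 1))%N.
  rewrite orderE -cZ -cardsT; congr #|pred_of_set _|; apply/setP => z; rewrite inE.
  by have [j ->] := gZ z; rewrite mem_cycle.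
have cZZ (x y : Z) : commute x y.
  by have [i ->] := gZ x; have [j ->] := gZ y; apply: commuteX2.
have e3 : (3 * m - 1 = (3 * m - 2).+1)%N by clear -m1; lia.
pose k := t ^+ (2 ^ (3 * m - 2)).
have k2 : k ^+ 2 = 1 by rewrite -expgM -expnSr -e3.
have oa : odd a.
  case: va => o _ e; rewrite -(subnKC a0) e oddD oddM oddX; case: (m) m1 => //.
have ka : k ^+ a = k.
  by rewrite -(odd_double_half a) oa expgD expg1 -mul2n expgM k2 expg1n mulg1.
have N0 := p2 (2 * m - 1).
have sM : {morph (fun x : Z => x ^+ a) : x y / x * y} by move=> x y; apply: expgMn.
(* The group is abelian and a^N = 1 modulo 2^(m + (2m-1)), the order of t, so both sides are x. *)
have sN x : iter (2 ^ (2 * m - 1)) (fun x : Z => x ^+ a) x = x ^ k.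
  have it j z : iter j (fun x : Z => x ^+ a) z = z ^+ (a ^ j).
    by elim: j z => [|j IH] z; rewrite ?expg1 //= IH -expgM expnSr.
  rewrite it; have -> : x ^ k = x by apply/conjg_fixP/commgP.
  case: va => u ou Ea; have Ea' : a = (1 + 2 ^ m * u)%N by rewrite -Ea subnKC.
  have [y vy] := v2is_lift m1 ou (v2isX2 (2 * m - 1)).
  rewrite -Ea' => ->; rewrite expgS; have [j ->] := gZ x.
  rewrite -expgM [X in _ * X](expg_dvd1 tn) ?mulg1 //; apply: dvdn_mull.
  by have := v2is_dvd vy; congr (_ ^ _ %| _); clear -m1; lia.
have [E [i [C [[injI iM] [iC CN] cE gE UP]]]] := cyclic_ext N0 sM ka sN.
have iX := morphfX iM.
exists E, (i t), C; split.
- by split; rewrite ?iC ?iX // -iX ?tn ?(morphf1 iM).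
- rewrite -iX -(morphf1 iM) (inj_eq injI) -order_dvdn ot gtnNdvd // ltn_exp2l //.
  by rewrite e3.
- by rewrite cE cZ.
- by move=> z; have [j [x ->]] := gE z; have [l ->] := gZ x; exists j, l; rewrite iX.
move=> hT x y [xy xn yN]; have [f [fM ft]] := UPZ hT x xn.
have [||F [FM Fi FC]] := UP hT f y fM.
- move=> z; have [j ->] := gZ z; rewrite !(morphfX fM) ft conjXg xy -!expgM mulnC //.
- by rewrite yN /k (morphfX fM) ft.
by exists F; rewrite Fi ft.
Qed.

(** * The endomorphism of <A, C> that becomes conjugation by y *)

Section RelAC.
Variables (m a : nat) (gT : finGroupType) (A C : gT).
Hypotheses (m1 : 1 < m) (va : v2is m (a - 1)) (R : rel_AC m a A C).
Let N := (2 ^ (2 * m - 1))%N.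
Let q := (2 ^ m)%N.
Let t := A ^+ N.

Lemma relAC_eq : exists2 u, odd u & a = (1 + 2 ^ m * u)%N.
Proof.
case: va => u ou e; exists u => //; rewrite -e subnKC //.
by have := v2is_gt0 va; rewrite subn_gt0 => /ltnW.
Qed.

Lemma relAC_Nq : (N * q = 2 ^ (3 * m - 1))%N.
Proof. by rewrite -expnD; congr (2 ^ _)%N; clear -m1; lia. Qed.

Lemma relAC_N2 : (N * 2 = 2 ^ (2 * m))%N.
Proof. by rewrite -expnSr; congr (2 ^ _)%N; clear -m1; lia. Qed.

Lemma relAC_tA : commute t A. Proof. exact/commute_sym/commuteX. Qed.

Lemma relAC_tC : commute t C.
Proof.
apply/commgP/conjg_fixP; have [e n _] := R; have [u ou Ea] := relAC_eq.
rewrite conjXg e -expgM Ea mulnDl mul1n expgD [X in _ * X](expg_dvd1 n) ?mulg1 //.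
by rewrite -relAC_Nq; apply/dvdnP; exists u; rewrite /q; ring.
Qed.

Lemma relAC_tX k : 2 ^ m %| k -> t ^+ k = 1.
Proof. by apply: expg_dvd1; have [_ n _] := R; rewrite -expgM relAC_Nq. Qed.

Lemma relAC_th : t ^+ (2 ^ (m - 1)) = A ^+ (2 ^ (3 * m - 2)).
Proof. by rewrite -expgM -expnD; congr (A ^+ (2 ^ _)); clear -m1; lia. Qed.

Lemma relAC_C1 k : 2 ^ (2 * m) %| k -> C ^+ k = 1.
Proof.
apply: expg_dvd1; have [_ n e] := R.
rewrite -relAC_N2 expgM e -relAC_th -expgM -expnSr; apply: relAC_tX.
by apply: dvdn_exp2l; clear -m1; lia.
Qed.

Lemma relAC_sq (x : nat) : 2 %| x -> t ^+ (x * 2 ^ (m - 1)) = 1.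
Proof.
case/dvdnP => y ->; apply: relAC_tX; rewrite -mulnA -expnS; apply: dvdn_mull.
by apply: dvdn_exp2l; clear -m1; lia.
Qed.

(** Here a^q - 1 has valuation 2m, so the correction exponent vanishes modulo 2^(3m-1): in these
    n-th powers A and C^q behave as if they commuted. *)
Lemma relAC_cexp_aq n : (exists2 s, m <= s & v2is s n) \/ n = a ->
  2 ^ (3 * m - 1) %| cexp (a ^ q) n.
Proof.
have [u ou Ea] := relAC_eq.
have [w vw Ew] := v2is_lift m1 ou (v2isX2 m).
rewrite Ea Ew -/q; case: vw => z oz ->; rewrite addnn -mul2n.
have m2 : 1 < 2 * m by clear -m1; lia.
have vu : v2is m (2 ^ m * u) by exists u.
have m0 : 0 < m by apply: ltnW.
case=> [[s ms vs] | ->].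
  apply: dvdn_trans (v2is_dvd (v2is_cexp m2 oz _ vs)).
    by apply: dvdn_exp2l; clear -ms m1; lia.
  exact: leq_trans m0 ms.
rewrite add1n cexpS; apply: dvdn_mull; apply: dvdn_add.
  apply: dvdn_trans (v2is_dvd (v2is_cexp m2 oz m0 vu)).
  by apply: dvdn_exp2l; clear -m1; lia.
have [w' vw' ->] := v2is_lift m2 oz vu; rewrite addKn.
by apply: dvdn_trans (v2is_dvd vw'); apply: dvdn_exp2l; clear -m1; lia.
Qed.

Lemma relAC_expACq n : (exists2 s, m <= s & v2is s n) \/ n = a ->
  (A * C ^+ q) ^+ n = A ^+ n * C ^+ (q * n).
Proof.
move=> hn; have [e n1 _] := R.
have a0 : 0 < a ^ q by have [u _ ->] := relAC_eq; rewrite expn_gt0.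
have e' : A ^ (C ^+ q) = A ^+ (a ^ q) by have := conjXX 1 q e; rewrite expg1 mul1n.
by have := expMg_cexp n a0 e'; rewrite (expg_dvd1 n1 (relAC_cexp_aq hn)) mulg1 -expgM.
Qed.

Lemma relAC_central i x : commute t x -> commute (t ^+ i) x.
Proof. by move=> c; apply/commute_sym/commuteX/commute_sym. Qed.

Lemma relAC_tACq i : commute (t ^+ i) (A * C ^+ q).
Proof.
apply: relAC_central; apply: commuteM; first exact: relAC_tA.
by apply: commuteX; apply: relAC_tC.
Qed.

Lemma relAC_twistN i : (t ^+ i * (A * C ^+ q)) ^+ N = t.
Proof.
rewrite expgMn; last exact: relAC_tACq.
rewrite relAC_expACq; last by left; exists (2 * m - 1); [clear -m1; lia | apply: v2isX2].
rewrite relAC_C1 ?mulg1; last first.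
  by rewrite -expnD; apply: dvdn_exp2l; clear -m1; lia.
rewrite -(expgM t) relAC_tX ?mul1g //.
by apply: dvdn_mull; apply: dvdn_exp2l; clear -m1; lia.
Qed.

(** Makes A -> t^i A C^q, C -> t^j C an endomorphism; the central factors t^i and t^j are invisible
    to the relations. *)
Lemma relAC_twist i j : 2 %| j -> rel_AC m a (t ^+ i * (A * C ^+ q)) (t ^+ j * C).
Proof.
move=> dj; have [e n1 CN] := R; have [u ou Ea] := relAC_eq.
have X3 : (t ^+ i * (A * C ^+ q)) ^+ (2 ^ (3 * m - 2)) = A ^+ (2 ^ (3 * m - 2)).
  have -> : (2 ^ (3 * m - 2) = N * 2 ^ (m - 1))%N.
    by rewrite -expnD; congr (2 ^ _)%N; clear -m1; lia.
  by rewrite expgM relAC_twistN -expgM.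
split.
- have -> : (t ^+ i * (A * C ^+ q)) ^ (t ^+ j * C) = t ^+ i * (A ^+ a * C ^+ q).
    rewrite conjgM; have -> : (t ^+ i * (A * C ^+ q)) ^ (t ^+ j) = t ^+ i * (A * C ^+ q).
      apply/conjg_fixP/commgP/commute_sym.
      by apply: commuteM; [apply: commuteX2 | apply: relAC_tACq].
    rewrite !conjMg e; congr (_ * (_ * _)).
      by apply/conjg_fixP/commgP; apply: relAC_central; apply: relAC_tC.
    by apply/conjg_fixP/commgP/commute_sym/commuteX.
  rewrite expgMn; last exact: relAC_tACq.
  rewrite relAC_expACq; last by right.
  congr (_ * (_ * _)).
    rewrite -(expgM t) Ea mulnDr muln1 (expgD t) [X in _ * X]relAC_tX ?mulg1 //.
    by rewrite mulnCA dvdn_mulr.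
  rewrite Ea mulnDr muln1 expgD [X in _ * X]relAC_C1 ?mulg1 //.
  by rewrite mulnA -expnD addnn -mul2n dvdn_mulr.
- by rewrite -relAC_Nq expgM relAC_twistN relAC_tX.
rewrite X3 expgMn ?CN //; last by apply: relAC_central; apply: relAC_tC.
rewrite -(expgM t) relAC_tX ?mul1g // ; apply: dvdn_mull; apply: dvdn_exp2l; clear -m1; lia.
Qed.

End RelAC.

(* Here y plays the role of B^(2^m). *)
Definition rel_ACy (m a i j l : nat) (gT : finGroupType) (A C y : gT) : Prop :=
  let t := A ^+ (2 ^ (2 * m - 1)) in
  [/\ rel_AC m a A C, A ^ y = t ^+ i * (A * C ^+ (2 ^ m)), C ^ y = t ^+ j * C
    & y ^+ (2 ^ (m - 1)) = t ^+ l].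

Lemma model_ACy m a i j l : 1 < m -> v2is m (a - 1) -> odd i -> 2 %| j ->
  exists (E : finGroupType) (A C y : E),
  [/\ rel_ACy m a i j l A C y, A ^+ (2 ^ (3 * m - 2)) != 1,
      #|E| = (2 ^ (m - 1) * (2 ^ (2 * m - 1) * 2 ^ (3 * m - 1)))%N,
      forall z, exists n k i, z = y ^+ n * (C ^+ k * A ^+ i) &
      forall (hT : finGroupType) (x z w : hT), rel_ACy m a i j l x z w ->
        exists F : E -> hT, [/\ {morph F : u v / u * v}, F A = x, F C = z & F y = w]].
Proof.
move=> m1 va oi dj; have [K [A [C [R An cK gK UP]]]] := model_AC m1 va.
set N := (2 ^ (2 * m - 1))%N; set q := (2 ^ m)%N.
have [s [sM sA sC]] := UP _ _ _ (relAC_twist m1 va R i dj).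
pose t := A ^+ N; rewrite -/N -/q -/t in sA sC.
have Et : t = A ^+ N by [].
have st : s t = t by rewrite (morphfX sM) sA (relAC_twistN m1 va R).
have tz k z : commute (t ^+ k) z.
  have [n [p ->]] := gK z; apply: relAC_central; apply: commuteM; apply: commuteX.
    exact: relAC_tC m1 va R.
  exact: relAC_tA.
have tX k : q %| k -> t ^+ k = 1 by apply: relAC_tX m1 R _.
have tsq x : 2 %| x -> t ^+ (x * 2 ^ (m - 1)) = 1 by apply: relAC_sq m1 R _.
have th : t ^+ (2 ^ (m - 1)) = A ^+ (2 ^ (3 * m - 2)) by apply: relAC_th.
clearbody t.
have sCq : s (C ^+ q) = C ^+ q.
  rewrite (morphfX sM) sC expgMn; last exact: tz.
  by rewrite -expgM tX ?mul1g // dvdn_mull.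
have stX k : s (t ^+ k) = t ^+ k by rewrite (morphfX sM) st.
have sCX k : s ((C ^+ q) ^+ k) = (C ^+ q) ^+ k by rewrite (morphfX sM) sCq.
have itA n : iter n s A = t ^+ (n * i) * (A * (C ^+ q) ^+ n).
  elim: n => [|n IH]; first by rewrite mul1g mulg1.
  by rewrite iterS IH !sM stX sCX sA mulSnr expgD expgS !mulgA.
have itC n : iter n s C = t ^+ (n * j) * C.
  elim: n => [|n IH]; first by rewrite mul1g.
  by rewrite iterS IH !sM stX sC mulSnr expgD mulgA.
(* The accumulated power of C is C^N = t^(2^(m-1)), so the total factor is t^((i+1) 2^(m-1)), which
   is trivial because i is odd. *)
have idA : iter (2 ^ (m - 1)) s A = A.
  rewrite itA mulnC.
  have -> : (C ^+ q) ^+ (2 ^ (m - 1)) = t ^+ (2 ^ (m - 1)).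
    rewrite th -expgM; have [_ _ <-] := R; congr (C ^+ _).
    by rewrite -expnD; congr (2 ^ _)%N; clear -m1; lia.
  rewrite mulgA (tz _ A) -mulgA -expgD -mulSnr tsq ?mulg1 //.
  by rewrite dvdn2 /= oi.
have idC : iter (2 ^ (m - 1)) s C = C by rewrite itC mulnC tsq ?mul1g.
have p0 : 0 < 2 ^ (m - 1) by rewrite expn_gt0.
have stl : s (t ^+ l) = t ^+ l by [].
have sid x : iter (2 ^ (m - 1)) s x = x ^ (t ^+ l).
  have sMi := iter_morph (2 ^ (m - 1)) sM.
  have [n [p ->]] := gK x; rewrite sMi !(morphfX sMi) idA idC.
  by apply/esym/conjg_fixP/commgP/commute_sym.
have [E [f [y [[injf fM] [fy yn] cE gE UPE]]]] := cyclic_ext p0 sM stl sid.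
have fX := morphfX fM; have f1 := morphf1 fM.
have [e n1 CN] := R.
exists E, (f A), (f C), y; split.
- split.
  + by split; [rewrite -(morphfJ fM) e fX | rewrite -fX n1 | rewrite -!fX CN].
  + by rewrite fy sA !fM !fX Et fX.
  + by rewrite fy sC fM fX Et fX.
  + by rewrite yn Et !fX.
- by rewrite -fX -f1 (inj_eq injf).
- by rewrite cE cK.
- move=> z; have [n [x ->]] := gE z; have [k [p ->]] := gK x.
  by exists n, k, p; rewrite fM !fX.
move=> hT x z w [Rx xw zw wX]; have [g [gM gA gC]] := UP _ _ _ Rx.
have gt : g t = x ^+ N by rewrite Et (morphfX gM) gA.
have [||F [FM Ff Fy]] := UPE hT g w gM.
- move=> v; have [k [p ->]] := gK v.
  rewrite !sM !(morphfX sM) sA sC !gM !(morphfX gM) !gM !(morphfX gM) gt gA gC.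
  by rewrite conjMg !conjXg xw zw.
- by rewrite wX (morphfX gM) gt.
by exists F; rewrite !Ff gA gC.
Qed.

Lemma bin2_pow m : 0 < m -> ('C(2 ^ m, 2) = 2 ^ (m - 1) * (2 ^ m - 1))%N.
Proof.
case: m => // m _; rewrite bin2 subn1 /= expnS -mulnA mul2n doubleK subn1; lia.
Qed.

Lemma dvdn_bin3_pow m : 2 ^ m %| 'C(2 ^ m, 3).
Proof.
have := mul_bin_diag (2 ^ m) 2; move=> e.
have : 2 ^ m %| 3 * 'C(2 ^ m, 3) by rewrite -e dvdn_mulr.
by rewrite Gauss_dvdr // coprimeXl.
Qed.

(* The congruence on kap is what (A C)^(y^v C) = (A C)^a amounts to, i.e. it is the condition
   for A -> A C, C -> y^v C, y -> y to respect the relations. *)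
Section RelACy.
Variables (m u v r kap : nat) (gT : finGroupType) (A C y : gT).
Let a := (1 + 2 ^ m * u)%N.
Let b := (1 + 2 ^ m * v)%N.
Let q := (2 ^ m)%N.
Let N := (2 ^ (2 * m - 1))%N.
(** With y as B^q and B^N as t^kap, [i] comes from the leading term q v 'C(q, 2) = N v (q-1) of
    [cexp b q] in A^(B^q), and [j] from (b-1) q = 2 N v in C^(B^q). *)
Let i := (kap * (v * (q - 1)))%N.
Let j := (2 * (v * kap))%N.
Hypotheses (m1 : 1 < m) (ou : odd u).
Hypothesis Ear : cexp a a = (a * (N * r))%N.
Hypothesis Eab : exists2 w, odd w & a = b + N * w %[mod 2 ^ (2 * m)].
Hypothesis Ekap : (kap * (v * v) + r)%N = (2 ^ (m - 1))%N %[mod q].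
Hypothesis R : rel_ACy m a i j kap A C y.
Hypothesis gK : forall z, exists n k i, z = y ^+ n * (C ^+ k * A ^+ i).
Let t := A ^+ N.
Let h := A ^+ (2 ^ (3 * m - 2)).

Let va : v2is m (a - 1). Proof. by exists u => //; rewrite addKn. Qed.
Let RA : rel_AC m a A C. Proof. by case: R. Qed.
Let Ay : A ^ y = t ^+ i * (A * C ^+ q). Proof. by case: R. Qed.
Let Cy : C ^ y = t ^+ j * C. Proof. by case: R. Qed.
Let yX : y ^+ (2 ^ (m - 1)) = t ^+ kap. Proof. by case: R. Qed.
Let dj : 2 %| j. Proof. exact: dvdn_mulr. Qed.

Let tz k z : commute (t ^+ k) z.
Proof.
have ty : commute t y.
  by apply/commgP/conjg_fixP; rewrite conjXg Ay (relAC_twistN m1 va RA).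
have [n [p [l ->]]] := gK z; apply: relAC_central; apply: commuteM; first exact: commuteX.
apply: commuteM; apply: commuteX; first exact: relAC_tC m1 va RA.
exact: relAC_tA.
Qed.

Let tX k : q %| k -> t ^+ k = 1. Proof. exact: relAC_tX m1 RA _. Qed.
Let tsq x : 2 %| x -> t ^+ (x * 2 ^ (m - 1)) = 1. Proof. exact: relAC_sq m1 RA _. Qed.
Let th : t ^+ (2 ^ (m - 1)) = h. Proof. exact: relAC_th. Qed.
Let CN : C ^+ N = h. Proof. by case: RA. Qed.
Let q2 : (2 ^ (m - 1) * 2 = q)%N.
Proof. by rewrite -expnSr; congr (2 ^ _)%N; clear -m1; lia. Qed.

Let tmod k l : k = l %[mod q] -> t ^+ k = t ^+ l.
Proof.
by move=> e; rewrite -(expg_mod k (tX (dvdnn q))) e expg_mod //; apply: tX.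
Qed.

Let ta : t ^+ a = t.
Proof. by rewrite expgD [X in _ * X]tX ?mulg1 // dvdn_mulr. Qed.

Let hodd o : odd o -> h ^+ o = h.
Proof.
move=> oo; rewrite -th -expgM; apply: tmod.
rewrite -(odd_double_half o) oo mulnDr muln1 -mul2n mulnA q2 addnC.
by rewrite mulnC modnMDl.
Qed.

(** Both C^N and the correction A^(cexp a N) equal h, so they cancel. *)
Lemma relACy_ACN : (A * C) ^+ N = t.
Proof.
have [e n1 _] := RA; have a0 : 0 < a by [].
have := expMg_cexp N a0 e; rewrite CN.
have s0 : 0 < 2 * m - 1 by clear -m1; lia.
have := v2is_cexp m1 ou s0 (v2isX2 _); rewrite -/a -/N; case=> o oo ->.
have -> : ((m + (2 * m - 1)).-1 = 3 * m - 2)%N by clear -m1; lia.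
by rewrite expgM hodd // => /mulIg.
Qed.

Lemma relACy_Cy n : C * y ^+ n = t ^+ (j * n) * (y ^+ n * C).
Proof.
elim: n => [|n IH]; first by rewrite muln0 !mul1g mulg1.
have e : C * y = t ^+ j * (y * C).
  by apply: (mulgI y^-1); rewrite -conjgE Cy [RHS]mulgA -(tz _ y^-1) -mulgA mulKg.
rewrite expgSr mulgA IH -!mulgA e [y ^+ n * (t ^+ j * _)]mulgA -(tz j (y ^+ n)).
by rewrite -!mulgA [LHS]mulgA -expgD mulnSr.
Qed.

Lemma relACy_pow n : (y ^+ v * C) ^+ n = t ^+ (j * v * 'C(n, 2)) * (y ^+ (v * n) * C ^+ n).
Proof.
have c : [~ C, y ^+ v] = t ^+ (j * v).
  rewrite commgEl; have -> : C ^ (y ^+ v) = t ^+ (j * v) * C.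
    by rewrite conjgE relACy_Cy mulgA -(tz _ (y ^- v)) -!mulgA mulKg.
  by rewrite (tz _ C) mulKg.
have cc z : commute z [~ C, y ^+ v] by rewrite c; apply: commute_sym; apply: tz.
rewrite (expMg_Rmul _ (cc _) (cc _)) c.
by rewrite -(expgM t) -(expgM y) -(tz (j * v * 'C(n, 2)) (y ^+ (v * n) * C ^+ n)).
Qed.

Lemma relACy_yq x : y ^+ (q * x) = t ^+ (2 * kap * x).
Proof. by rewrite -q2 -mulnA expgM yX -(expgM t); congr (t ^+ _); ring. Qed.

Lemma relACy_powq : (y ^+ v * C) ^+ q = t ^+ j * C ^+ q.
Proof.
rewrite relACy_pow bin2_pow ?(ltnW m1) // mulnCA [(_ ^ _ * _)%N]mulnC tsq; last first.
  by rewrite -mulnA dvdn_mulr.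
rewrite mul1g mulnC relACy_yq; congr (t ^+ _ * _); rewrite /j; ring.
Qed.

Lemma relACy_powN : (y ^+ v * C) ^+ N = h.
Proof.
rewrite relACy_pow bin2_pow; last by clear -m1; lia.
rewrite mulnCA [(_ ^ _ * _)%N]mulnC tX; last first.
  by apply: dvdn_mull; apply: dvdn_exp2l; clear -m1; lia.
rewrite mul1g; have -> : N = (q * 2 ^ (m - 1))%N.
  by rewrite -expnD; congr (2 ^ _)%N; clear -m1; lia.
rewrite mulnCA relACy_yq tX ?mul1g.
  rewrite -CN; congr (C ^+ _); rewrite -expnD; congr (2 ^ _)%N; clear -m1; lia.
by apply/dvdnP; exists (kap * v)%N; rewrite -q2; ring.
Qed.

Lemma relACy_conjyA n : A ^ (y ^+ n) = t ^+ (i * n) * (A * C ^+ (q * n)).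
Proof.
have CqY : (C ^+ q) ^ y = C ^+ q.
  rewrite conjXg Cy expgMn; last exact: tz.
  by rewrite -(expgM t) tX ?mul1g // dvdn_mull.
elim: n => [|n IH]; first by rewrite conjg1 !muln0 mul1g mulg1.
have tY k : (t ^+ k) ^ y = t ^+ k by apply/conjg_fixP/commgP.
rewrite expgSr conjgM IH !conjMg tY Ay (expgM C) conjXg CqY -(expgM C) !mulnS.
by rewrite [t ^+ (i + _)]expgD [C ^+ (q + _)]expgD -!mulgA [LHS]mulgA
  -(tz _ (t ^+ _)) -mulgA.
Qed.

Lemma relACy_conjyC n : C ^ (y ^+ n) = t ^+ (j * n) * C.
Proof. by rewrite conjgE relACy_Cy mulgA -(tz _ (y ^- n)) -!mulgA mulKg. Qed.

Lemma relACy_mulg x z (p p' : gT) : t ^+ x * p * (t ^+ z * p') = t ^+ (x + z) * (p * p').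
Proof. by rewrite -mulgA (mulgA p) -(tz z p) -(mulgA _ p) [LHS]mulgA -expgD. Qed.

Lemma relACy_image : rel_ACy m a i j kap (A * C) (y ^+ v * C) y.
Proof.
have ACN := relACy_ACN; have [e n1 _] := RA; have a0 : 0 < a by [].
have AC3 : (A * C) ^+ (2 ^ (3 * m - 2)) = h.
  have -> : (2 ^ (3 * m - 2) = N * 2 ^ (m - 1))%N.
    by rewrite -expnD; congr (2 ^ _)%N; clear -m1; lia.
  by rewrite expgM ACN th.
split; rewrite -/N ?ACN //; first split.
- have := expMg_cexp a a0 e; rewrite Ear mulnA mulnC mulnA.
  have -> : A ^+ (r * a * N) = t ^+ r.
    by rewrite mulnC expgM -/t mulnC expgM ta.
  have [w ow ew] := Eab.
  have -> : C ^+ a = C ^+ b * h.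
    have C2 : C ^+ (2 ^ (2 * m)) = 1 by apply: relAC_C1 m1 RA _ _.
    by rewrite -(expg_mod a C2) ew (expg_mod _ C2) expgD expgM CN hodd.
  move=> E; apply: (mulIg (t ^+ r)); rewrite E.
  have -> : (A * C) ^ (y ^+ v * C) = (A ^ (y ^+ v) * C ^ (y ^+ v)) ^ C 
    by rewrite conjgM [(A * C) ^ (y ^+ v)]conjMg.
  rewrite relACy_conjyA relACy_conjyC.
  have tC k : (t ^+ k) ^ C = t ^+ k by apply/conjg_fixP/commgP.
  have CC k : (C ^+ k) ^ C = C ^+ k by apply/conjg_fixP/commgP/commute_sym/commuteX.
  have CC1 : C ^ C = C := CC 1%N.
  have -> : (t ^+ (i * v) * (A * C ^+ (q * v)) * (t ^+ (j * v) * C)) ^ C =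
      t ^+ (i * v) * (A ^+ a * C ^+ (q * v)) * (t ^+ (j * v) * C).
    rewrite [LHS]conjMg [(t ^+ (i * v) * _) ^ C]conjMg [(t ^+ (j * v) * _) ^ C]conjMg.
    by rewrite !tC CC1 [(A * _) ^ C]conjMg e CC.
  rewrite relACy_mulg -mulgA -(tz _ (_ * _)) mulgA -expgD -(mulgA (A ^+ a)) -expgSr.
  rewrite -[(q * v).+1]add1n.
  rewrite -/b (mulgA (A ^+ a)) -th -(tz _ (A ^+ a * C ^+ b)).
  (* Only exponents of t remain: i v + j v + r on one side, and 2^(m-1) from h = C^(N w) on the
     other. *)
  congr (_ * _); apply: tmod; rewrite -Ekap.
  have -> : (i * v + j * v = kap * (v * v) + kap * (v * v) * q)%N.
    rewrite /i /j; have -> : q = (q - 1).+1 by rewrite subn1 prednK // expn_gt0.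
    by rewrite subn1 /=; ring.
  by rewrite addnAC addnC modnMDl.
- by rewrite -relAC_Nq // expgM ACN tX.
- by rewrite relACy_powN AC3.
- rewrite conjMg Ay Cy relACy_powq -(mulgA (t ^+ i)); congr (_ * _).
  rewrite (mulgA _ (t ^+ j)) -(tz j (A * C ^+ q)) (mulgA (A * C)) -(tz j (A * C)).
  by rewrite -!mulgA -!expgS -expgSr.
- have yy : (y ^+ v) ^ y = y ^+ v by apply/conjg_fixP/commgP/commute_sym/commuteX.
  by rewrite conjMg yy Cy mulgA -(tz j (y ^+ v)) mulgA.
Qed.

(** The condition for adjoining B with B^q = y. The factor t^i of A^y comes from y^(v 'C(q, 2)),
    through y^(2^(m-1)) = t^kap; the other powers of t collected on the way have exponents divisible
    by q. *)
Lemma relACy_iter (s : gT -> gT) : {morph s : x y / x * y} ->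
  s A = A * C -> s C = y ^+ v * C -> s y = y -> forall x, iter q s x = x ^ y.
Proof.
move=> sM sA sC sy.
have sX := morphfX sM.
have st k : s (t ^+ k) = t ^+ k by rewrite !sX sA relACy_ACN.
have syX k : s (y ^+ k) = y ^+ k by rewrite sX sy.
have itC n : iter n s C = y ^+ (v * n) * C.
  elim: n => [|n IH]; first by rewrite muln0 mul1g.
  by rewrite iterS IH sM syX sC mulgA -expgD mulnSr.
have ity n : iter n s y = y by elim: n => // n IH; rewrite iterS IH.
have itA n : iter n s A =
    t ^+ (j * v * (2 * 'C(n, 3) + 'C(n, 2))) * (A * (y ^+ (v * 'C(n, 2)) * C ^+ n)).
  elim: n => [|n IH]; first by rewrite !bin0n !muln0 !mulg1 mul1g.
  rewrite iterS IH sM st sM sA sM syX sX sC relACy_pow.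
  set c := 'C(n, 2).
  have -> : A * C * (y ^+ (v * c) * (t ^+ (j * v * c) * (y ^+ (v * n) * C ^+ n))) =
      t ^+ (j * v * c + j * (v * c + v * n)) * (A * (y ^+ (v * c + v * n) * C ^+ n.+1)).
    rewrite (mulgA (y ^+ (v * c))) -(tz _ (y ^+ (v * c))) -(mulgA _ (y ^+ (v * c))).
    rewrite (mulgA (A * C)) -(tz _ (A * C)) -(mulgA _ (A * C)) expgD -[RHS]mulgA.
    congr (_ * _); rewrite (mulgA (y ^+ (v * c))) -expgD -(mulgA A).
    have -> p : C * (y ^+ p * C ^+ n) = t ^+ (j * p) * (y ^+ p * C ^+ n.+1).
      by rewrite mulgA relACy_Cy -!mulgA -expgS.
    by rewrite mulgA -(tz _ A) -mulgA.
  rewrite mulgA -expgD; congr (t ^+ _ * (A * (y ^+ _ * _))).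
    by rewrite !binS bin1 -/c; ring.
  by rewrite binS bin1 -/c; ring.
have sMq := iter_morph q sM.
have Aq : iter q s A = A ^ y.
  rewrite itA Ay bin2_pow ?(ltnW m1) // tX.
    have -> : (v * (2 ^ (m - 1) * (2 ^ m - 1)) = 2 ^ (m - 1) * (v * (q - 1)))%N.
      by rewrite mulnCA.
    rewrite mul1g expgM yX -(expgM t) -/i (mulgA A) -(tz i A) mulgA //.
  have /dvdnP[x ->] := dvdn_bin3_pow m.
  apply/dvdnP; exists (v * kap * v * (4 * x + (2 ^ m - 1)))%N.
  by move: (2 ^ m - 1)%N => d; rewrite /j -/q -q2; ring.
have Cq : iter q s C = C ^ y.
  by rewrite itC Cy mulnC relACy_yq; congr (t ^+ _ * _); rewrite /j; ring.
move=> x; have [n [k [l ->]]] := gK x.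
have sqX := morphfX sMq.
rewrite !sMq !sqX Aq Cq ity conjMg [(C ^+ k * _) ^ y]conjMg !conjXg.
by congr (_ ^+ _ * _); rewrite conjgE mulKg.
Qed.
End RelACy.

Lemma mac_model m u v w a b : 1 < m -> odd u -> odd v -> odd w ->
  a = (1 + 2 ^ m * u)%N -> b = (1 + 2 ^ m * v)%N ->
  a = b + 2 ^ (2 * m - 1) * w %[mod 2 ^ (2 * m)] ->
  exists (E : finGroupType) (A B : E),
  [/\ mac a b A B, A ^+ (2 ^ (3 * m - 2)) != 1, #|E| = (2 ^ (7 * m - 3))%N
    & [set: E] = <<[set A; B]>>].
Proof.
move=> m1 ou ov ow Ea Eb Eab.
have va : v2is m (a - 1) by exists u => //; rewrite Ea addKn.
have [r [or Er]] : exists r, odd r /\ cexp a a = (a * (2 ^ (2 * m - 1) * r))%N.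
  have [x [r or ->] e] := v2is_cexp_self m1 ou.
  by exists r; split => //; rewrite Ea e subn1.
have [kap [ok Ek]] : exists kap, odd kap /\
    (kap * (v * v) + r = 2 ^ (m - 1) %[mod 2 ^ m])%N.
  have ovv : odd (v * v) by rewrite oddM ov.
  have [l ol El] := odd_inv_mod m ovv.
  (* This is (2^(m-1) - r) / v^2 modulo 2^m. It is odd because m > 1 and r is odd, which makes i odd
     as [model_ACy] requires. *)
  exists (l * (2 ^ (m - 1) + r * (2 ^ m - 1)))%N; split.
    rewrite oddM ol oddD oddM or oddB ?expn_gt0 // !oddX /=.
    by case: (m) m1 => [|[|n]].
  rewrite mulnAC -modnDml -modnMml [(l * _)%N]mulnC El modnMml mul1n modnDml.
  rewrite -addnA -{2}[r]muln1 -mulnDr subnK ?expn_gt0 // addnC modnMDl //.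
pose i := (kap * (v * (2 ^ m - 1)))%N; pose j := (2 * (v * kap))%N.
have oi : odd i by rewrite !oddM ok ov oddB ?expn_gt0 // oddX orbF; case: (m) m1.
have dj : 2 %| j by apply: dvdn_mulr.
have [K [A [C [y [R An cK gK UP]]]]] := model_ACy kap m1 va oi dj.
have Eab' : exists2 w, odd w & a = b + 2 ^ (2 * m - 1) * w %[mod 2 ^ (2 * m)] by exists w.
rewrite Ea Eb in R Er Eab' UP.
have [s [sM sA sC sy]] := UP _ _ _ _ (relACy_image m1 ou Er Eab' Ek R gK).
have sn := relACy_iter m1 ou R gK sM sA sC sy.
have [|E [f [B [[injf fM] [fB BX] cE gE _]]]] := cyclic_ext _ sM sy sn.
  by rewrite expn_gt0.
have fX := morphfX fM.
have AB : f A ^ B = f A * f C by rewrite fB sA fM.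
have EC : [~ f A, B] = f C by rewrite commgEl AB mulKg.
have [[e _ _] _ _ _] := R.
exists E, (f A), B; split.
- split; first by rewrite EC -(morphfJ fM) e fX Ea.
  rewrite -invg_comm EC conjgE invgK.
  have : f C ^ B = B ^+ (2 ^ m * v) * f C by rewrite fB sC fM fX -BX expgM.
  rewrite conjgE => /(congr1 (mulg B)); rewrite mulKVg => E1.
  by rewrite mulgA E1 mulgA -expgS mulgK Eb add1n.
- by rewrite -fX -(morphf1 fM) (inj_eq injf).
- by rewrite cE cK -!expnD; congr (2 ^ _)%N; clear -m1; lia.
apply/eqP; rewrite eqEsubset subsetT andbT; apply/subsetP => z _.
have gA : f A \in <<[set f A; B]>> by rewrite mem_gen ?set21.
have gB : B \in <<[set f A; B]>> by rewrite mem_gen ?set22.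
have gC : f C \in <<[set f A; B]>> by rewrite -EC groupR.
have [n [x ->]] := gE z; have [k [p [l ->]]] := gK x.
by rewrite !fM !fX -BX !groupM ?groupX.
Qed.

(** * Integer parameters and the Sylow projection *)

Import Num.Theory.

Lemma v2_int (z : int) k : (z != 0)%R -> v2 z = k ->
  exists c : int, (z = (2 ^ k)%N%:Z * (2 * c + 1))%R.
Proof.
rewrite /v2 -absz_gt0 => z0 <-; have [o co E] := pfactor_coprime (isT : prime 2) z0.
move: E; set k' := logn _ _ => E.
have oo : odd o by rewrite -coprime2n.
case: z z0 @k' E => n _ k' /= E.
  exists (Posz o./2); have := odd_double_half o; rewrite oo E; lia.
  exists (- Posz (uphalf o))%R; have := odd_double_half o; rewrite uphalf_half oo.
  by move: E; rewrite NegzE; lia.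
Qed.

Lemma int_nat_rep (z : int) M : 0 < M -> exists (n : nat) (k : int), (z = n%:Z + k * M%:Z)%R.
Proof.
move=> M0; exists `|(z %% Posz M)%Z|%N, (z %/ Posz M)%Z.
by rewrite gez0_abs ?modz_ge0 1?addrC -?divz_eq //; lia.
Qed.

Lemma eqmod_int (x y M : nat) (k : int) : (x%:Z = y%:Z + k * M%:Z)%R -> x = y %[mod M].
Proof.
move=> e; have : (Posz x = Posz y %[mod Posz M])%Z by rewrite e addrC modzMDl.
by rewrite !modz_nat => -[].
Qed.

Lemma expgz_nat (gT : finGroupType) (x : gT) (z : int) (n M : nat) (k : int) :
  (z = n%:Z + k * M%:Z)%R -> #[x] %| M -> expgz x z = x ^+ n.
Proof.
move=> e xM; have xM1 : x ^+ M = 1 by apply/eqP; rewrite -order_dvdn.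
case: z e => p e /=.
  by rewrite -(expg_mod p xM1) (eqmod_int e) expg_mod.
apply/eqP; rewrite eq_invg_mul -expgD -order_dvdn; apply: dvdn_trans xM _.
have : (Posz M %| Posz (p.+1 + n)%N)%Z.
  apply/dvdzP; exists (- k)%R; move: e; rewrite NegzE PoszD; lia.
by rewrite dvdzE.
Qed.

(** The modulus serves two groups at once: with g = |G| it is a multiple of the element orders in G
    and of those in the model, of order 2^(7m-3). The factor 2^(7m) also preserves the valuation of
    z - 1. *)
Lemma nat_rep (z : int) m g : 1 < m -> (z != 1)%R -> v2 (z - 1)%R = m -> 0 < g ->
  exists (u : nat) (k : int),
    odd u /\ (z = (1 + 2 ^ m * u)%N%:Z + k * (2 ^ (7 * m) * g)%N%:Z)%R.
Proof.
move=> m1 z1 vz g0.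
have [|c Ec] := @v2_int (z - 1)%R m _ vz; first by rewrite subr_eq0.
have M0 : 0 < 2 ^ (7 * m) * g by rewrite muln_gt0 expn_gt0.
have [n [k Ek]] := int_nat_rep z M0.
have e1 : (2 ^ (7 * m) * g = 2 ^ m * (2 * (2 ^ (6 * m - 1) * g)))%N.
  by rewrite [(2 * _)%N]mulnA -expnS mulnA -expnD; congr (2 ^ _ * _)%N; clear -m1; lia.
set h := (2 ^ (6 * m - 1) * g)%N in e1.
have En : (n%:Z = 1 + (2 ^ m)%N%:Z * (2 * (c - k * h%:Z) + 1))%R.
  have -> : (n%:Z = z - k * (2 ^ (7 * m) * g)%N%:Z)%R by rewrite {1}Ek addrK.
  rewrite e1 !PoszM; have -> : z = (1 + (z - 1))%R by rewrite addrC subrK.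
  by rewrite Ec; ring.
set d := (c - k * h%:Z)%R in En.
have d0 : (0 <= d)%R.
  have : (4 <= 2 ^ m)%N by apply: (@leq_pexp2l 2 2).
  case: (lerP 0 d) => // dn p4; exfalso.
  have : ((2 ^ m)%N%:Z * (2 * d + 1) <= - 4%:Z)%R by clear -p4 dn; nia.
  clear -En; lia.
exists (2 * `|d|%N + 1)%N, k; split; first by rewrite addn1 /= oddM.
rewrite Ek; congr (_ + _)%R; rewrite En; clear -d0.
by rewrite PoszD PoszM PoszD PoszM gez0_abs.
Qed.

Lemma order_2pow (gT : finGroupType) (x : gT) k :
  x ^+ (2 ^ k.+1) = 1 -> x ^+ (2 ^ k) != 1 -> #[x] = (2 ^ k.+1)%N.
Proof.
move=> e; have : #[x] %| 2 ^ k.+1 by rewrite order_dvdn e.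
case/dvdn_pfactor => // l lk El.
rewrite -order_dvdn El => nd; congr (2 ^ _)%N; apply/eqP; rewrite eqn_leq lk ltnNge.
by apply: contra nd => ?; apply: dvdn_exp2l.
Qed.

Lemma morph_gen (gT hT : finGroupType) (f : gT -> hT) (X : {set gT}) :
  {morph f : x y / x * y} -> f @: <<X>> = <<f @: X>>.
Proof.
move=> fM; pose phi := Morphism (in2W fM : {in [set: gT] &, {morph f : x y / x * y}}).
have E (Y : {set gT}) : f @: Y = phi @* Y by rewrite morphimE setTI.
by rewrite !E morphim_gen ?subsetT.
Qed.

(** For pi = 2 this is the canonical projection onto the Sylow 2-subgroup; nilpotency makes taking
    2-parts multiplicative. *)
Lemma nilpotent_consttM (gT : finGroupType) (pi : nat_pred) :
  nilpotent [set: gT] -> {morph (fun x : gT => x.`_pi) : x y / x * y}.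
Proof.
move=> nG x y; have /dprodP[_ _ cP _] := nilpotent_pcoreC pi nG.
have H rho z : z.`_rho \in 'O_rho([set: gT]).
  by rewrite (mem_normal_Hall (nilpotent_pcore_Hall _ nG) (pcore_normal _ _)) ?inE ?p_elt_constt.
have c u v : u \in 'O_pi([set: gT]) -> v \in 'O_pi^'([set: gT]) -> commute u v.
  by move=> hu hv; apply: commute_sym; apply: (centsP cP).
have E : x * y = (x.`_pi * y.`_pi) * (x.`_pi^' * y.`_pi^').
  rewrite -{1}(consttC pi x) -{1}(consttC pi y) -!mulgA; congr (_ * _).
  by rewrite !mulgA (c _ _ (H _ _) (H _ _)).
have h1 : x.`_pi * y.`_pi \in 'O_pi([set: gT]) by rewrite groupM.
have h2 : x.`_pi^' * y.`_pi^' \in 'O_pi^'([set: gT]) by rewrite groupM.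
rewrite {1}E consttM; last exact: c.
rewrite constt_p_elt ?(mem_p_elt (pcore_pgroup _ _) h1) //.
have /constt1P -> : pi^'.-elt (x.`_pi^' * y.`_pi^') by apply: mem_p_elt h2; apply: pcore_pgroup.
by rewrite mulg1.
Qed.

Lemma morphfR (gT hT : finGroupType) (f : gT -> hT) :
  {morph f : x y / x * y} -> {morph f : x y / [~ x, y]}.
Proof. by move=> fM x y; rewrite !commgEl fM (morphfV fM) (morphfJ fM). Qed.

Theorem theorem16p1 (alpha beta : int) (m : nat) (gT : finGroupType) (A B : gT) :
  alpha != 1%R -> beta != 1%R ->
  v2 (alpha - 1)%R = m -> v2 (beta - 1)%R = m -> (1 < m)%N ->
  v2 (alpha - beta)%R = (2 * m - 1)%N ->
  is_Gpres alpha beta A B ->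
  forall S : {group gT}, S \in 'Syl_2([set: gT]) ->
    [/\ #|S| = (2 ^ (7 * m - 3))%N,
        nil_class S = 5%N,
        #[(A.`_2)%g]%g = (2 ^ (3 * m - 1))%N,
        #[(B.`_2)%g]%g = (2 ^ (3 * m - 1))%N
      & #[(([~ A, B]).`_2)%g]%g = (2 ^ (2 * m))%N].
Proof.
move=> a1 b1 va vb m1 vab [GAB [[rA rB] UP]] S; rewrite inE => sS.
have g0 : 0 < #|[set: gT]| by apply: cardG_gt0.
set M := (2 ^ (7 * m) * #|[set: gT]|)%N.
have M0 : 0 < M by rewrite muln_gt0 expn_gt0.
have [u [ka [ou Ea]]] := nat_rep m1 a1 va g0.
have [v [kb [ov Eb]]] := nat_rep m1 b1 vb g0.
rewrite -/M in Ea Eb.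
set a := (1 + 2 ^ m * u)%N in Ea; set b := (1 + 2 ^ m * v)%N in Eb.
have p2 k : 0 < 2 ^ k by rewrite expn_gt0.
(* [v2 0] is 0 by convention, whereas 2m-1 > 0. *)
have vab0 : (alpha - beta != 0)%R.
  apply/eqP => e; move: vab; rewrite e (_ : v2 0 = 0%N) //.
  by clear -m1; lia.
have [c Ec] := v2_int vab0 vab.
(* Reducing modulo the even number 2M keeps w odd. *)
have [w [kw Ew]] := @int_nat_rep (2 * c + 1)%R (2 * M) (ltn_mul (isT : 1 < 2) M0).
pose N := (2 ^ (2 * m - 1))%N; rewrite -/N in Ec.
have ow : odd w.
  have : (w%:Z = 2 * (c - kw * M%:Z) + 1)%R.
    by have -> : (w%:Z = 2 * c + 1 - kw * (2 * M)%N%:Z)%R; [rewrite Ew addrK | rewrite PoszM; ring].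
  by clear; lia.
have Eab : a = b + N * w %[mod M].
  apply: (@eqmod_int _ _ _ (kb - ka + 2 * N%:Z * kw)%R).
  have -> : (a%:Z = (alpha - beta) + beta - ka * M%:Z)%R by rewrite subrK Ea addrK.
  by rewrite Ec Ew {1}Eb PoszD !PoszM; ring.
have dM k : k <= 7 * m -> 2 ^ k %| M by move=> h; rewrite dvdn_mulr // dvdn_exp2l.
have oM (x : gT) : #[x] %| M by rewrite dvdn_mull // order_dvdG ?inE.
have mac1 : mac a b A B.
  by split; rewrite -?(expgz_nat Ea (oM _)) -?(expgz_nat Eb (oM _)).
have nG : nilpotent [set: gT].
  have e2 : (2 ^ m = 2 * 2 ^ (m - 1))%N by rewrite -expnS; congr (2 ^ _)%N; clear -m1; lia.
  have ev x : ~~ odd (2 ^ (m - 1) * x).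
    by rewrite oddM oddX orbF; case: (m) m1 => [|[|n]].
  have p0 x : odd x -> 0 < 2 ^ (m - 1) * x by move=> /odd_gt0 h; rewrite muln_gt0 p2.
  rewrite GAB; apply: (@mac_nilpotent (2 ^ (m - 1) * u) (2 ^ (m - 1) * v)); rewrite ?p0 ?ev //.
  by rewrite !mulnA -e2.
have piM := nilpotent_consttM 2 nG.
set pi := (fun x : gT => x.`_2) in piM.
have piX := morphfX piM; have piJ := morphfJ piM; have piR := morphfR piM.
have SO : S :=: 'O_2([set: gT]) by apply: nilpotent_Hall_pcore.
have piS x : pi x \in S.
  by rewrite SO (mem_normal_Hall (nilpotent_pcore_Hall _ nG) (pcore_normal _ _)) ?inE ?p_elt_constt.
have SE : S = <<[set pi A; pi B]>> :> {set gT}.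
  have <- : pi @: [set: gT] = <<[set pi A; pi B]>>.
    rewrite GAB (morph_gen _ piM); congr <<_>>; apply/setP => x; rewrite !inE.
    apply/imsetP/orP => [[y] | [] /eqP->].
    - by rewrite !inE => /orP[] /eqP-> ->; rewrite eqxx; auto.
    - by exists A; rewrite ?set21.
    - by exists B; rewrite ?set22.
  apply/eqP; rewrite eqEsubset; apply/andP; split; apply/subsetP => x.
    move=> xS; apply/imsetP; exists x; rewrite ?inE //.
    by rewrite /pi constt_p_elt //; apply: mem_p_elt xS; apply: pHall_pgroup sS.
  by case/imsetP => y _ ->.
have mac2' : mac2 m a b (pi A) (pi B).
  case: mac1 => e1 e2; split.
  - by split; rewrite -piR -piJ ?e1 ?e2 piX.
  - by exists u => //; rewrite addKn.
  - by exists v => //; rewrite addKn.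
  - by rewrite -piR; split; apply: p_elt_constt.
  exists w => //; have h : [~ pi A, pi B] ^+ M = 1 by apply/eqP; rewrite -order_dvdn.
  by rewrite -(expg_mod a h) Eab expg_mod.
have Eab2 : a = b + N * w %[mod 2 ^ (2 * m)].
  have d : 2 ^ (2 * m) %| M by apply: dM; rewrite leq_mul2r orbT.
  by rewrite -(modn_dvdm a d) Eab modn_dvdm.
have [E [x [y [macE xn cE gE]]]] := mac_model m1 ou ov ow (erefl a) (erefl b) Eab2.
have oE (z : E) : #[z] %| M.
  apply: dvdn_trans (order_dvdG (in_setT z)) _; rewrite cardsT cE; apply: dM; exact: leq_subr.
have [|f [fM [fA fB]]] := UP E x y.
  by case: macE => e1 e2; split; rewrite ?(expgz_nat Ea (oE _)) ?(expgz_nat Eb (oE _)).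
(* The model is a 2-group, so f kills the odd part of z. *)
have f2 z : f (pi z) = f z.
  rewrite -{2}(consttC 2 z) fM; have -> : f z.`_2^' = 1; last by rewrite mulg1.
  have o1 : #[f z.`_2^'] %| #[z.`_2^'] by rewrite order_dvdn -(morphfX fM) expg_order (morphf1 fM).
  have o2 : #[f z.`_2^'] %| 2 ^ (7 * m - 3) by rewrite -cE -cardsT order_dvdG ?inE.
  have : #[f z.`_2^'] %| gcdn #[z.`_2^'] (2 ^ (7 * m - 3)) by rewrite dvdn_gcd o1.
  have /eqP -> : coprime #[z.`_2^'] (2 ^ (7 * m - 3)).
    rewrite coprimeXr // coprime_sym prime_coprime // -p'natE //.
    exact: p_elt_constt.
  by rewrite dvdn1 order_eq1 => /eqP.
have fX := morphfX fM; have an : pi A ^+ (2 ^ (3 * m - 2)) != 1.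
  by apply: contra xn => /eqP e; rewrite -fA -f2 -fX e (morphf1 fM).
(* By [f2] the restriction of f to S still hits both generators of the model, so S maps onto it. *)
have cS : #|S| = (2 ^ (7 * m - 3))%N.
  apply/eqP; rewrite eqn_leq {1}SE (mac2_card m1 mac2') -cE -cardsT /=.
  apply: leq_trans (leq_imset_card f S); apply: subset_leq_card.
  rewrite SE (morph_gen _ fM) gE genS //; apply/subsetP => z; rewrite !inE.
  case/orP => /eqP->; apply/imsetP; first by exists (pi A); rewrite ?set21 ?f2.
  by exists (pi B); rewrite ?set22 ?f2.
have nS : nilpotent S by apply: nilpotentS nG; apply: subsetT.
have e3 : (3 * m - 1 = (3 * m - 2).+1)%N by clear -m1; lia.
have e2 : (2 * m = (2 * m - 1).+1)%N by clear -m1; lia.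
have CX := mac2_CN_B m1 mac2'; have CXA := mac2_CN_A m1 mac2'.
split => //.
- apply/eqP; rewrite eqn_leq; apply/andP; split.
    by apply/(lcn_nil_classP 5 nS); rewrite SE; apply: mac2_lcn6 m1 mac2'.
  rewrite ltnNge; apply/negP => /(lcn_nil_classP 4 nS); rewrite SE; apply/eqP.
  apply: (mac2_lcn5_neq1 m1 mac2'); apply: contra an => /eqP e.
  by apply/eqP; apply: (expg_dvd1 e); apply: dvdn_exp2l; clear -m1; lia.
- by rewrite e3; apply: order_2pow; rewrite -?e3 //; apply: mac2_expA m1 mac2'.
(* The three powers B^(2^(3m-2)), C^N and A^(2^(3m-2)) coincide, so the one nontrivial power found
   in the model settles all three orders. *)
- rewrite e3; apply: order_2pow; rewrite -?e3; first exact: mac2_expA m1 (mac2_sym mac2').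
  by rewrite -[X in X != _]CX CXA.
rewrite -[_.`_2]/(pi [~ A, B]) piR e2; apply: order_2pow; rewrite ?CXA //.
by rewrite expnSr expgM CXA -expgM -expnSr -e3; apply: mac2_expA m1 mac2'.
Qed.
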